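(* Let $n\ge 1$, $-\frac n2\le m\le\frac{n-4}{2}$, and let $B\subset\mathbb{R}^n$ be a ball centered at $0$. Then $$\inf_{u\in H^2(B)\cap H^1_0(B)\setminus\{0\}}\frac{\int_B\frac{|\Delta u|^2}{|x|^{2m}}dx}{\int_B\frac{u^2}{|x|^{2m+4}}dx}=\inf_{u\in H^2_0(B)\setminus\{0\}}\frac{\int_B\frac{|\Delta u|^2}{|x|^{2m}}dx}{\int_B\frac{u^2}{|x|^{2m+4}}dx}.$$
   Context: Functions $u$ for which the numerator is infinite are disregarded in the infima; a ratio with finite numerator and infinite denominator is read as $0$. *)

(* Defs.v *)
(* Sobolev spaces on open subsets of R^n. *)
From HB Require Import structures.
From mathcomp Require Import all_boot all_order all_algebra.
From mathcomp Require Import all_classical all_reals all_analysis.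
Set Implicit Arguments.
Unset Strict Implicit.
Unset Printing Implicit Defensive.
Import Order.TTheory GRing.Theory Num.Theory.
Import numFieldNormedType.Exports.
Local Open Scope classical_set_scope.
Local Open Scope ring_scope.

Definition rowvec_display : measure_display.
Proof. exact: default_measure_display. Qed.

(* 'rV[R]_n carries the product sigma-algebra, i.e. the Borel one. *)
Section rowvec_measurable.
Context {R : realType} {n : nat}.

Let coor : 'I_n -> 'rV[R]_n -> measurableTypeR R := fun i x => x 0 i.

Let rowvec_set0 : g_sigma_preimage coor set0.
Proof. exact: sigma_algebra0. Qed.

Let rowvec_setC A : g_sigma_preimage coor A -> g_sigma_preimage coor (~` A).
Proof. exact: sigma_algebraC. Qed.

Let rowvec_bigcup (F : (set 'rV[R]_n)^nat) :
  (forall i, g_sigma_preimage coor (F i)) ->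
  g_sigma_preimage coor (\bigcup_i (F i)).
Proof. exact: sigma_algebra_bigcup. Qed.

HB.instance Definition _ := @isMeasurable.Build rowvec_display
  'rV[R]_n (g_sigma_preimage coor) rowvec_set0 rowvec_setC rowvec_bigcup.

End rowvec_measurable.

Lemma measurable_coor {R : realType} {n : nat} (i : 'I_n) :
  measurable_fun [set: 'rV[R]_n] (fun x => x 0 i : measurableTypeR R).
Proof.
move=> _ Y mY; rewrite setTI; apply: sub_sigma_algebra => /=.
rewrite -bigcup_seq/=; exists i => /=; first by rewrite mem_index_enum.
by exists Y => //; rewrite setTI.
Qed.

Lemma measurable_fun_rV {R : realType} {n : nat} d (T : measurableType d)
    (f : T -> 'rV[R]_n) :
  (forall i, measurable_fun [set: T] (fun x => f x 0 i : measurableTypeR R)) ->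
  measurable_fun [set: T] f.
Proof.
move=> mf _ A mA; rewrite setTI; move: A mA.
pose S := [set A : set 'rV[R]_n | measurable (f @^-1` A)].
suff : measurable `<=` S by [].
apply: smallest_sub.
  split=> [|A SA|F SF].
  - by rewrite /S/= preimage_set0.
  - by rewrite /S/= setTD preimage_setC; exact: measurableC.
  - rewrite /S/= preimage_bigcup; apply: bigcup_measurable => k _; exact: SF.
rewrite -bigcup_seq; apply: bigcup_sub => i _ _ [B mB <-].
by rewrite /S/= setTI -[X in measurable X]setTI; exact: mf.
Qed.

Definition cons_rV {R : realType} {n : nat} (p : measurableTypeR R * 'rV[R]_n)
 : 'rV[R]_n.+1 :=
  \row_i (if unlift ord0 i is Some j then p.2 0 j else p.1).

Definition uncons_rV {R : realType} {n : nat} (x : 'rV[R]_n.+1)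
  : measurableTypeR R * 'rV[R]_n := (x 0 ord0, \row_j x 0 (lift ord0 j)).

Lemma cons_rV0 {R : realType} {n : nat} (p : measurableTypeR R * 'rV[R]_n) :
  cons_rV p 0 ord0 = p.1.
Proof. by rewrite mxE unlift_none. Qed.

Lemma cons_rVS {R : realType} {n : nat} (p : measurableTypeR R * 'rV[R]_n) j :
  cons_rV p 0 (lift ord0 j) = p.2 0 j.
Proof. by rewrite mxE liftK. Qed.

Lemma cons_rVK {R : realType} {n : nat} :
  cancel (@cons_rV R n) (@uncons_rV R n).
Proof.
move=> [a x]; rewrite /uncons_rV cons_rV0; congr pair.
by apply/rowP => j; rewrite mxE cons_rVS.
Qed.

Lemma measurable_cons_rV {R : realType} {n : nat} :
  measurable_fun setT (@cons_rV R n).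
Proof.
apply: measurable_fun_rV => i; case: (unliftP ord0 i) => [j|] ->.
  under eq_fun do rewrite cons_rVS.
  by apply: (measurableT_comp (measurable_coor j)) => //; exact: measurable_snd.
under eq_fun do rewrite cons_rV0.
exact: measurable_fst.
Qed.

Lemma measurable_uncons_rV {R : realType} {n : nat} :
  measurable_fun setT (@uncons_rV R n).
Proof.
apply/measurable_fun_pairP; split; first exact: measurable_coor.
apply: measurable_fun_rV => i.
rewrite (_ : (fun _ => _) = fun x : 'rV[R]_n.+1 => x 0 (lift ord0 i)).
  exact: measurable_coor.
by apply/funext => x; rewrite /= mxE.
Qed.

(* n-dimensional Lebesgue measure, as an n-fold product. *)
Fixpoint lebesgue_rV {R : realType} (n : nat) : set 'rV[R]_n -> \bar R :=
  match n with
  | 0%N => dirac (0 : 'rV[R]_0)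
  | n'.+1 => pushforward (@lebesgue_measure R \x @lebesgue_rV R n')%E cons_rV
  end.

Section lebesgue_rV_measure.
Context {R : realType}.
Local Open Scope ereal_scope.

Let is_sfm n (mu : set 'rV[R]_n -> \bar R) := [/\ mu set0 = 0,
  forall A, 0 <= mu A, semi_sigma_additive mu & sigma_finite setT mu].

Let is_sfmS n (mu : {sigma_finite_measure set 'rV[R]_n -> \bar R}) :
  is_sfm (pushforward (@lebesgue_measure R \x mu) (@cons_rV R n)).
Proof.
have mcons A : measurable A -> measurable (@cons_rV R n @^-1` A).
  by move=> mA; rewrite -[X in measurable X]setTI; exact: measurable_cons_rV.
split.
- by rewrite /pushforward preimage_set0 measure0.
- by move=> A; rewrite /pushforward; exact: measure_ge0.
- move=> F mF tF mUF; rewrite /pushforward preimage_bigcup.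
  apply: measure_semi_sigma_additive.
  + by move=> k; exact: mcons.
  + apply/trivIsetP => /= i j _ _ ij; rewrite -preimage_setI.
    by move/trivIsetP : tF => /(_ _ _ _ _ ij) ->//; rewrite preimage_set0.
  + by rewrite -preimage_bigcup; exact: mcons.
- have [G GT G_fin] : sigma_finite setT (@lebesgue_measure R \x mu).
    have /sigma_finiteP[F [TF ndF Foo]] := sigma_finiteT (@lebesgue_measure R).
    have /sigma_finiteP[G [TG ndG Goo]] := sigma_finiteT mu.
    exists (fun k => F k `*` G k).
      rewrite -setXTT TF TG predeqE => -[x y]; split.
        move=> [/= [i _ Fx] [k _ Gy]]; exists (maxn i k) => //; split.
        - by move: x Fx; exact/subsetPset/ndF/leq_maxl.
        - by move: y Gy; exact/subsetPset/ndG/leq_maxr.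
      by move=> [k _ []/= ? ?]; split; exists k.
    move=> k; have [? ?] := Foo k; have [? ?] := Goo k.
    split; first exact: measurableX.
    by rewrite product_measure1E// lte_mul_pinfty// ge0_fin_numE.
  exists (fun k => @uncons_rV R n @^-1` G k).
    by rewrite -preimage_bigcup -GT preimage_setT.
  move=> k; have [mG pG] := G_fin k; split.
    by rewrite -[X in measurable X]setTI; exact: measurable_uncons_rV.
  rewrite /pushforward -comp_preimage (_ : _ \o _ = id) ?preimage_id//.
  by apply/funext => q; exact: cons_rVK.
Qed.

Let is_sfm_lebesgue n : is_sfm (@lebesgue_rV R n).
Proof.
elim: n => [|n [mu0 mu_ge0 mu_add mu_fin]].
  split; [exact: measure0|exact: measure_ge0|exact: measure_semi_sigma_additive|].
  exact: sigma_finiteT.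
pose M := isMeasure.Build _ _ _ (@lebesgue_rV R n) mu0 mu_ge0 mu_add.
pose mm : {measure set 'rV[R]_n -> \bar R} := HB.pack (@lebesgue_rV R n) M.
pose S := Measure_isSigmaFinite.Build _ _ _ mm mu_fin.
exact: (is_sfmS (HB.pack_for {sigma_finite_measure set 'rV[R]_n -> \bar R}
  (@lebesgue_rV R n) M S)).
Qed.

Let lebesgue_rV0 n : @lebesgue_rV R n set0 = 0.
Proof. by case: (is_sfm_lebesgue n). Qed.

Let lebesgue_rV_ge0 n A : 0 <= @lebesgue_rV R n A.
Proof. by case: (is_sfm_lebesgue n). Qed.

Let lebesgue_rV_additive n : semi_sigma_additive (@lebesgue_rV R n).
Proof. by case: (is_sfm_lebesgue n). Qed.

HB.instance Definition _ n := isMeasure.Build _ _ _ (@lebesgue_rV R n)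
  (@lebesgue_rV0 n) (@lebesgue_rV_ge0 n) (@lebesgue_rV_additive n).

Let lebesgue_rV_sigma_finite n : sigma_finite setT (@lebesgue_rV R n).
Proof. by case: (is_sfm_lebesgue n). Qed.

HB.instance Definition _ n := Measure_isSigmaFinite.Build _ _ _
  (@lebesgue_rV R n) (@lebesgue_rV_sigma_finite n).

End lebesgue_rV_measure.

Lemma lebesgue_rV_box {R : realType} n (a b : 'rV[R]_n) : (forall i, a 0 i <= b 0 i) ->
  lebesgue_rV [set x : 'rV[R]_n | forall i, x 0 i \in `[a 0 i, b 0 i]] =
  (\prod_(i < n) (b 0 i - a 0 i))%:E.
Proof.
elim: n a b => [|n IHn] a b ab.
  rewrite big_ord0 /= diracE mem_set//= => -[//].
have mbox k (c d : 'rV[R]_k) :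
    measurable [set x : 'rV[R]_k | forall i, x 0 i \in `[c 0 i, d 0 i]].
  rewrite (_ : [set x | _] = \bigcap_(i in [set: 'I_k])
      ((fun x : 'rV[R]_k => x 0 i : measurableTypeR R) @^-1`
        [set` `[c 0 i, d 0 i]])).
    apply: fin_bigcap_measurable => // i _; rewrite -[X in measurable X]setTI.
    exact: measurable_coor.
  by apply/seteqP; split => x /= h i; [move=> _; exact: h|exact: (h i)].
have -> : lebesgue_rV [set x : 'rV[R]_n.+1 | forall i, x 0 i \in `[a 0 i, b 0 i]] =
    (@lebesgue_measure R \x @lebesgue_rV R n)%E (([set` `[a 0 ord0, b 0 ord0]] : set (measurableTypeR R)) `*`
      [set x : 'rV[R]_n | forall i, x 0 i \in `[(uncons_rV a).2 0 i, (uncons_rV b).2 0 i]]).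
  congr (product_measure1 _ _ _); apply/seteqP; split => -[t x] /= h.
    split; first by move: (h ord0); rewrite cons_rV0.
    by move=> i; move: (h (lift ord0 i)); rewrite cons_rVS !mxE.
  move=> i; case: (unliftP ord0 i) => [j|] ->; last by rewrite cons_rV0; case: h.
  by rewrite cons_rVS; case: h => _ /(_ j); rewrite !mxE.
rewrite product_measure1E//; last exact: mbox.
rewrite big_ord_recl EFinM; congr (_ * _)%E.
  rewrite [LHS]lebesgue_measure_itv/= lte_fin lt_neqAle ab andbT EFinB.
  by case: eqVneq => //= ->; rewrite subee.
rewrite [LHS]IHn; last by move=> i; rewrite !mxE.
by congr EFin; apply: eq_bigr => i _; rewrite !mxE.
Qed.

Section sobolev.
Context {R : realType} {n : nat}.
Implicit Types (W : set 'rV[R]_n) (u v phi : 'rV[R]_n -> R) (s : seq 'I_n).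

Local Notation mu := (@lebesgue_rV R n).

(* The norm of 'rV[R]_n in the library is the sup norm. *)
Definition enorm (x : 'rV[R]_n) : R := Num.sqrt (\sum_(i < n) x 0 i ^+ 2).

Definition eball (r : R) : set 'rV[R]_n := [set x | enorm x < r].

(* A list s of coordinate directions stands for a multi-index of order size s;
   every multi-index has such a representative. *)
Definition partials s phi : 'rV[R]_n -> R :=
  foldr (fun i f => 'D_(delta_mx 0 i) f) phi s.

Definition smooth phi := forall s,
  continuous (partials s phi) /\
  forall i x, derivable (partials s phi) x (delta_mx 0 i).

Definition test_function W phi :=
  [/\ smooth phi, compact (closure [set x | phi x != 0]) &
      closure [set x | phi x != 0] `<=` W].

Definition loc_integrable W u := measurable_fun W u /\
  forall K, compact K -> K `<=` W -> mu.-integrable K (EFin \o u).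

Definition L2 W u := measurable_fun W u /\
  (\int[mu]_(x in W) (u x ^+ 2)%:E < +oo)%E.

Definition weak_partials W s u v :=
  [/\ loc_integrable W u, loc_integrable W v &
      forall phi, test_function W phi ->
        \int[mu]_(x in W) (u x * partials s phi x) =
        (-1) ^+ size s * \int[mu]_(x in W) (v x * phi x)].

(* The weak derivative, unique up to a null set, as a function of u;
   it is 0 if there is none. *)
Definition wpartials W s u : 'rV[R]_n -> R :=
  xget (cst 0) [set v | weak_partials W s u v].

Definition wlaplacian W u (x : 'rV[R]_n) : R :=
  \sum_(i < n) wpartials W [:: i; i] u x.

(* H^k(W); its elements are functions, not classes modulo null sets. *)
Definition sobolev (k : nat) W : set ('rV[R]_n -> R) :=
  [set u | L2 W u /\
    forall s, (size s <= k)%N -> exists2 v, weak_partials W s u v & L2 W v].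

(* H^k_0(W), the closure of the test functions in H^k(W). *)
Definition sobolev0 (k : nat) W : set ('rV[R]_n -> R) :=
  [set u | sobolev k W u /\
    exists phi : nat -> 'rV[R]_n -> R,
      (forall j, test_function W (phi j)) /\
      forall s, (size s <= k)%N ->
        (fun j => \int[mu]_(x in W)
           ((partials s (phi j) x - wpartials W s u x) ^+ 2)%:E)%E
        @ \oo --> 0%E].

Definition rellich_num (m : R) W u : \bar R :=
  (\int[mu]_(x in W) (`|wlaplacian W u x| ^+ 2 / enorm x `^ (2 * m))%:E)%E.

Definition rellich_den (m : R) W u : \bar R :=
  (\int[mu]_(x in W) (u x ^+ 2 / enorm x `^ (2 * m + 4))%:E)%E.

(* The quotient of extended reals satisfies r / +oo = 0 for finite r. *)
Definition rellich_inf (m : R) W (X : set ('rV[R]_n -> R)) : \bar R :=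
  ereal_inf [set (rellich_num m W u / rellich_den m W u)%E | u in
    [set u | [/\ X u, ~ {ae mu, forall x, W x -> u x = 0} &
                 (rellich_num m W u < +oo)%E]]].

End sobolev.

(* Main.v *)
(* Write gam = (n-4-2m)(n+2m)/4, which is nonnegative in the given range of m
   (and forces n >= 2). Both infima equal gam^2.

   Lower bound on H^2 \cap H^1_0: with rho = |x|^2 + e, p = -(m+1) and
   q = (n-4-2m)/4, pair -Lap u with u rho^p. Since u vanishes on the boundary,
   integration by parts and the Hardy inequality with ground state rho^(-q) give
   gam int u^2 rho^(p-1) <= int (-Lap u) u rho^p, hence, completing a square,
   gam^2 int u^2 rho^(p-1) <= int |Lap u|^2 rho^(p+1). All weights are smooth for
   e > 0, so nothing has to be known in advance about the denominator; then e
   tends to 0 by Fatou and dominated convergence.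

   Upper bound on H^2_0: cut |x|^(-2q) off to a long annulus around the origin.
   On the plateau both integrands are multiples of |x|^(-n), in ratio gam^2, and
   the measure |x|^(-n) dx gives the same mass to all dyadic shells, so the two
   transition shells are negligible as the number L of shells grows. *)

(* The exponent q solves 4q = n - 4 - 2m, so that both integrands for |x|^(-2q) scale like |x|^(-n);
   gam = 2q (n - 2 - 2q) is the factor in -Lap |x|^(-2q) = gam |x|^(-2q-2). The range of [m] enters
   through gam >= 0: the linear inequality has to be multiplied by gam before it can be fed into the
   expanded square.

   The obstacle is that a function in H^2 and H^1_0 carries no boundary condition on its gradient,
   so it cannot be approximated by test functions in H^2. Every integration by parts is therefore
   arranged to contain [u] as a factor, and only that factor is replaced by test functions
   converging in H^1; second derivatives enter through their weak identities alone.

   Weak derivatives are selected by choice and hence known only almost everywhere. The fundamental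
   lemma of the calculus of variations makes them unique, which identifies the weak Laplacian of the
   cut-off function with the classical one.

   Since H^2_0 is contained in H^2 and H^1_0, one inequality between the infima is immediate; only
   the other one needs the two bounds by gam^2. *)
Require Import Defs.
From mathcomp Require Import all_boot all_order all_algebra.
From mathcomp Require Import all_classical all_reals all_analysis.
From mathcomp Require Import measurable_realfun.
From mathcomp Require Import ring lra.
Import Order.TTheory GRing.Theory Num.Theory.
Import numFieldNormedType.Exports.
Local Open Scope classical_set_scope.
Local Open Scope ring_scope.

Set Implicit Arguments.
Unset Strict Implicit.
Unset Printing Implicit Defensive.

(** * C^k functions with respect to a family of directions *)

Section chain.
Context {R : realType} {V : normedModType R}.
Implicit Types (f g : V -> R) (x v : V).

Lemma derive_line f x v : 'D_v f x = 'D_1 (fun h : R => f (h *: v + x)) 0.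
Proof.
rewrite /derive; set g := fun h : R => f (h *: v + x).
suff -> : (fun h => h^-1 *: ((f \o shift x) (h *: v) - f x)) =
  (fun h => h^-1 *: ((g \o shift 0) (h *: 1) - g 0)) by [].
by apply/funext => h /=; rewrite /g addr0 scale0r add0r [h%:A]mulr1.
Qed.

(** Restricting to the line through [x] in direction [v] reduces this to the chain rule in one
    variable. Frechet differentiability of [h] is not assumed, because [smooth] only speaks of
    coordinate directions. *)
Lemma is_derive_comp1 (F : R -> R) (h : V -> R) x v :
  derivable h x v -> derivable F (h x) 1 ->
  is_derive x v (F \o h) ('D_1 F (h x) * 'D_v h x).
Proof.
move=> dh dF.
have dh' : derivable (fun t : R => h (t *: v + x)) 0 1.
  exact: (derivable1P _ _ _).1 dh.
have h0 : h (0 *: v + x) = h x by rewrite scale0r add0r.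
split.
  apply: (derivable1P _ _ _).2; apply/derivable1_diffP.
  have D1 : differentiable (fun t : R => h (t *: v + x)) 0 by apply/derivable1_diffP.
  have D2 : differentiable F (h (0 *: v + x)) by rewrite h0; apply/derivable1_diffP.
  exact: differentiable_comp D1 D2.
rewrite derive_line -derive1E.
rewrite (@derive1_comp _ (fun t : R => h (t *: v + x)) F) ?h0//.
by rewrite !derive1E -derive_line.
Qed.

End chain.

Section Ck.
Context {R : realType} {V : normedModType R} {I : Type} (e : I -> V).
Implicit Types (U : set V) (f g : V -> R) (k : nat).

(* Only the derivatives along the directions [e i] are required, as in [smooth]. *)
Fixpoint Ck k U f : Prop :=
  (forall x, U x -> {for x, continuous f}) /\
  if k is k'.+1 then
    forall i, (forall x, U x -> derivable f x (e i)) /\ Ck k' U ('D_(e i) f)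
  else True.

Lemma Ck_cont k U f : Ck k U f -> forall x, U x -> {for x, continuous f}.
Proof. by case: k => [|k] []. Qed.

Lemma CkS k U f : Ck k.+1 U f -> Ck k U f.
Proof.
elim: k f => [|k IH] f; first by case.
move=> [cf df]; split => // i; have [dfi Cfi] := df i.
by split => //; exact: IH.
Qed.

Lemma Ck_sub k U U' f : U' `<=` U -> Ck k U f -> Ck k U' f.
Proof.
move=> UU'; elim: k f => [|k IH] f [cf df]; split; try by move=> x /UU'/cf.
- by [].
- move=> i; have [dfi Cfi] := df i; split; last exact: IH.
  by move=> x /UU'/dfi.
Qed.

(** The conditions are pointwise and concern the derivatives of one globally defined function. This
    serves for a formula that is singular at 0 but multiplied by a factor vanishing near 0. *)
Lemma Ck_glue k U U' f : Ck k U f -> Ck k U' f -> Ck k (U `|` U') f.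
Proof.
elim: k f => [|k IH] f [cf df] [cf' df']; split; try by move=> x [/cf|/cf'].
- by [].
- move=> i; have [dfi Cfi] := df i; have [dfi' Cfi'] := df' i.
  by split; [move=> x [/dfi|/dfi']|exact: IH].
Qed.

(** Openness makes the functions agree near each point of [U], so their derivatives agree on [U] as
    well and the induction goes on. *)
Lemma Ck_eq k U f g : open U -> {in U, f =1 g} -> Ck k U f -> Ck k U g.
Proof.
move=> oU; elim: k f g => [|k IH] f g fg [cf df].
  split => // x Ux.
  have nfg : \near x, f x = g x.
    by near=> y; apply: fg; rewrite inE; near: y; exact: open_nbhs_nbhs.
  change (g @ x --> g x); rewrite -(fg x) ?inE//.
  apply: cvg_trans (cf x Ux).
  by apply: near_eq_cvg.
have nfg x : U x -> \near x, f x = g x.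
  move=> Ux; near=> y; apply: fg; rewrite inE; near: y; exact: open_nbhs_nbhs.
split.
  move=> x Ux; change (g @ x --> g x); rewrite -(fg x) ?inE//.
  by apply: cvg_trans (cf x Ux); apply: near_eq_cvg; exact: nfg.
move=> i; have [dfi Cfi] := df i; split.
  by move=> x Ux; apply: near_eq_derivable (dfi x Ux); exact: nfg.
apply: IH Cfi => x; rewrite inE => Ux.
by apply: near_eq_derive; exact: nfg.
Unshelve. all: by end_near. Qed.

Lemma Ck_cst k U (c : R) : Ck k U (cst c).
Proof.
elim: k c => [|k IH] c; split => //; try by move=> x _; exact: cvg_cst.
move=> i; split; first by move=> x _; exact: derivable_cst.
rewrite (_ : 'D_(e i) (cst c) = cst 0); first exact: IH.
by apply/funext => x; rewrite derive_cst.
Qed.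

Lemma CkD k U f g : open U -> Ck k U f -> Ck k U g -> Ck k U (f \+ g).
Proof.
move=> oU; elim: k f g => [|k IH] f g [cf df] [cg dg].
  by split => // x Ux; apply: cvgD; [exact: cf|exact: cg].
split; first by move=> x Ux; apply: cvgD; [exact: cf|exact: cg].
move=> i; have [dfi Cfi] := df i; have [dgi Cgi] := dg i; split.
  by move=> x Ux; apply: derivableD; [exact: dfi|exact: dgi].
apply: (@Ck_eq _ _ ('D_(e i) f \+ 'D_(e i) g)) => //; last exact: IH.
move=> x; rewrite inE => Ux /=.
by rewrite [RHS]deriveD//; [exact: dfi|exact: dgi].
Qed.

Lemma CkM k U f g : open U -> Ck k U f -> Ck k U g -> Ck k U (f \* g).
Proof.
move=> oU; elim: k f g => [|k IH] f g Cf Cg.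
  case: Cf => cf _; case: Cg => cg _.
  by split => // x Ux; apply: cvgM; [exact: cf|exact: cg].
case: (Cf) => cf df; case: (Cg) => cg dg.
split; first by move=> x Ux; apply: cvgM; [exact: cf|exact: cg].
move=> i; have [dfi Cfi] := df i; have [dgi Cgi] := dg i; split.
  by move=> x Ux; apply: derivableM; [exact: dfi|exact: dgi].
apply: (@Ck_eq _ _ ((f \* 'D_(e i) g) \+ (g \* 'D_(e i) f))) => //.
  move=> x; rewrite inE => Ux /=.
  by rewrite [RHS]deriveM//; [exact: dfi|exact: dgi].
by apply: CkD => //; apply: IH => //; exact: CkS.
Qed.

Lemma CkZ k U (c : R) f : open U -> Ck k U f -> Ck k U (fun x => c * f x).
Proof. by move=> oU Cf; exact: (CkM oU (@Ck_cst k U c) Cf). Qed.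

Lemma Ck_prod k U (J : Type) (s : seq J) (F : J -> V -> R) : open U ->
  (forall j, Ck k U (F j)) -> Ck k U (fun x => \prod_(j <- s) F j x).
Proof.
move=> oU CF; elim: s => [|j s IH].
  rewrite (_ : (fun _ => _) = cst 1); first exact: Ck_cst.
  by apply/funext => x; rewrite big_nil.
rewrite (_ : (fun _ => _) = F j \* (fun x => \prod_(j <- s) F j x)).
  exact: CkM.
by apply/funext => x; rewrite big_cons.
Qed.

Lemma Ck_sum k U (J : Type) (s : seq J) (F : J -> V -> R) : open U ->
  (forall j, Ck k U (F j)) -> Ck k U (fun x => \sum_(j <- s) F j x).
Proof.
move=> oU CF; elim: s => [|j s IH].
  rewrite (_ : (fun _ => _) = cst 0); first exact: Ck_cst.
  by apply/funext => x; rewrite big_nil.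
rewrite (_ : (fun _ => _) = F j \+ (fun x => \sum_(j <- s) F j x)).
  exact: CkD.
by apply/funext => x; rewrite big_cons.
Qed.

Lemma CkV k U f : open U -> (forall x, U x -> f x != 0) ->
  Ck k U f -> Ck k U (fun x => (f x)^-1).
Proof.
move=> oU f0; elim: k f f0 => [|k IH] f f0 Cf.
  by case: Cf => cf _; split => // x Ux; apply: cvgV; [exact: f0|exact: cf].
case: (Cf) => cf df; split.
  by move=> x Ux; apply: cvgV; [exact: f0|exact: cf].
move=> i; have [dfi Cfi] := df i; split.
  by move=> x Ux; apply: derivableV; [exact: f0|exact: dfi].
pose fV x := (f x)^-1.
apply: (@Ck_eq _ _ (fun x => -1 * (fV x * fV x * 'D_(e i) f x))) => //.
  move=> x; rewrite inE => Ux /=.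
  rewrite [RHS]deriveV//; [|exact: f0|exact: dfi].
  by rewrite /fV mulN1r scaleNr -invfM -expr2.
have CfV : Ck k U fV by apply: IH => //; exact: CkS.
by apply: CkZ => //; apply: CkM => //; exact: CkM.
Qed.

End Ck.

Section Ck_comp.
Context {R : realType} {V : normedModType R} {I : Type} (e : I -> V).

Definition Ck1 k (U : set R) (F : R -> R) := Ck (fun _ : unit => (1 : R)) k U F.

Lemma Ck_comp k (U : set V) (U1 : set R) (F : R -> R) (h : V -> R) : open U ->
  (forall x, U x -> U1 (h x)) -> Ck1 k U1 F -> Ck e k U h ->
  Ck e k U (F \o h).
Proof.
move=> oU hU; elim: k F => [|k IH] F CF Ch.
  case: CF => cF _; case: Ch => ch _; split => // x Ux.
  by apply: continuous_comp; [exact: ch|exact/cF/hU].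
case: (CF) => cF dF; case: (Ch) => ch dh; split.
  by move=> x Ux; apply: continuous_comp; [exact: ch|exact/cF/hU].
have [dF1 CF1] := dF tt.
move=> i; have [dhi Chi] := dh i; split.
  move=> x Ux; apply: ex_derive; apply: is_derive_comp1; first exact: dhi.
  exact/dF1/hU.
apply: (@Ck_eq _ _ _ _ _ _ (('D_1 F \o h) \* 'D_(e i) h)) => //.
  move=> x; rewrite inE => Ux /=.
  have [//||_ ->//] := @is_derive_comp1 _ _ F h x (e i); first exact: dhi.
  exact/dF1/hU.
by apply: CkM => //; apply: IH => //; exact: CkS.
Qed.

End Ck_comp.

(** * Smooth steps and bumps *)

Section flat.
Context {R : realType}.
Implicit Types (t : R) (k : nat).

(* The functions t^(-k) exp(-1/t), extended by 0 to t <= 0: the derivative of a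
   member of the family is a combination of two others, so all are smooth. *)
Definition flat k t : R := if 0 < t then t^-1 ^+ k * expR (- t^-1) else 0.

Lemma flat_ge0 k t : 0 <= flat k t.
Proof.
by rewrite /flat; case: ifPn => // t0; rewrite mulr_ge0 ?expR_ge0// exprn_ge0 ?invr_ge0 ?ltW.
Qed.

Lemma flat_gt0 k t : 0 < t -> 0 < flat k t.
Proof.
by move=> t0; rewrite /flat t0 mulr_gt0 ?expR_gt0//; apply: exprn_gt0; rewrite invr_gt0.
Qed.

Lemma flat_le0 k t : t <= 0 -> flat k t = 0.
Proof. by move=> t0; rewrite /flat ltNge t0. Qed.

(** From exp(s) >= s^(k+2) / (k+2)! at s = 1/t. The quadratic bound makes the difference quotients
    at 0 tend to 0, for every [k] alike. *)
Lemma flat_le k t : `|flat k t| <= (k.+2)`!%:R * t ^+ 2.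
Proof.
rewrite ger0_norm ?flat_ge0// /flat; case: ifPn => [t0|_]; last first.
  by rewrite mulr_ge0 ?sqr_ge0.
have tV0 : 0 < t^-1 by rewrite invr_gt0.
have H := expR_ge1Dxn k.+1 (ltW tV0).
have H2 : t^-1 ^+ k.+2 <= k.+2`!%:R * expR t^-1.
  rewrite mulrC -ler_pdivrMr ?ltr0n ?fact_gt0//; apply: le_trans H.
  by rewrite lerDr.
rewrite expRN ler_pdivrMr ?expR_gt0// mulrAC.
apply: le_trans (ler_wpM2r (sqr_ge0 t) H2).
rewrite -addn2 exprD -mulrA -exprMn mulVf ?gt_eqF//.
by rewrite expr1n mulr1.
Qed.

Lemma is_derive_flat k t :
  is_derive t 1 (flat k) (- k%:R * flat k.+1 t + flat k.+2 t).
Proof.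
have [t0|t0|->] := ltgtP t 0.
- rewrite !flat_le0 ?(ltW t0)// mulr0 addr0.
  apply: (@near_eq_is_derive _ _ _ (cst 0)).
  near=> y; rewrite flat_le0//; apply: ltW; near: y; exact: lt_nbhsl.
- have tN0 : t != 0 by rewrite gt_eqF.
  pose g t := t^-1 ^+ k * expR (- t^-1).
  apply: (@near_eq_is_derive _ _ _ g).
    by near=> y; rewrite /flat ifT//; near: y; exact: lt_nbhsr.
  have d1 : is_derive t 1 (fun t : R => - t^-1) (t ^- 2).
    apply: is_derive_eq; first by apply: is_deriveN; apply: is_deriveV.
    by rewrite scaleNr opprK [_ *: _]mulr1.
  have d2 : is_derive t 1 (fun t => expR (- t^-1)) (expR (- t^-1) * t ^- 2).
    have := @is_derive_comp1 _ _ expR (fun t : R => - t^-1) t 1.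
    have -> : 'D_1 expR (- t^-1) = expR (- t^-1) by rewrite -[in RHS]derive_expR.
    by rewrite derive_val; apply.
  have dV : is_derive t 1 (fun t : R => t^-1) (- t ^- 2).
    split; first by apply: (@derivableV _ _ id).
    rewrite (@deriveV _ _ id)//.
    by rewrite derive_id [_ *: _]mulr1.
  have d3 : is_derive t 1 (fun t : R => t^-1 ^+ k) (- k%:R * t^-1 ^+ k.+1).
    have dX := @is_deriveX _ _ (fun t : R => t^-1) k t 1 _ dV; rewrite exprfctE in dX.
    apply: (is_derive_eq dX).
    rewrite [LHS]mulrN mulNr; congr (- _).
    case: k {g dX} => [|k]; first by rewrite !mul0r.
    by rewrite -mulrA -exprVn -exprD addn2.
  apply: (is_derive_eq (is_deriveM d3 d2)).
  rewrite /flat t0 -exprVn ![_ *: _]mulrC. rewrite !exprS; ring.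

- rewrite !flat_le0// mulr0 addr0.
  suff H : (fun h : R => h^-1 *: ((flat k \o shift 0) (h *: 1) - flat k 0)) @ 0^' --> (0 : R).
    by split; [apply: cvgP H|exact: cvg_lim H].
  apply/cvgr0Pnorm_le => eps eps0; near=> h.
  have h0 : h != 0 by near: h; exact: nbhs_dnbhs_neq.
  rewrite /= addr0 [h%:A]mulr1 [flat k 0]flat_le0// subr0 normrZ normfV.
  rewrite ler_pdivrMl ?normr_gt0//; apply: le_trans (flat_le k h) _.
  rewrite -[h ^+ 2]real_normK ?num_real// expr2 mulrCA ler_wpM2l//.
  rewrite mulrC -ler_pdivlMr ?ltr0n ?fact_gt0//.
  near: h; apply: dnbhs0_le.
  by rewrite divr_gt0 ?ltr0n ?fact_gt0.
Unshelve. all: by end_near. Qed.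

End flat.

Lemma Ck_cstD {R : realType} {V : normedModType R} {I : Type} (e : I -> V) k U
    (f : V -> R) (c : I -> R) : continuous f ->
  (forall i x, is_derive x (e i) f (c i)) -> Ck e k U f.
Proof.
move=> cf df; case: k => [|k]; split => //; try by move=> x _; exact: cf.
move=> i; split; first by move=> x _; apply: ex_derive.
have -> : 'D_(e i) f = cst (c i) by apply/funext => x; exact: derive_val.
exact: Ck_cst.
Qed.

Section Ck1.
Context {R : realType}.
Implicit Types (U : set R) (k : nat) (F G : R -> R).

Lemma is_derive_continuous F (x d : R) : is_derive x 1 F d -> {for x, continuous F}.
Proof.
by move=> [dF _]; apply: differentiable_continuous; exact/derivable1_diffP.
Qed.

Lemma Ck1_affine k U (a b : R) : Ck1 k U (fun t => a * t + b).
Proof.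
have D (i : unit) (x : R) : is_derive x 1 (fun t : R => a * t + b) a.
  have H : (fun h : R => h^-1 *: (((fun t : R => a * t + b) \o shift x) (h *: 1) - (a * x + b))) @ 0^' --> a.
    apply: (@cvg_near_cst _ _ a); near=> h.
    rewrite /= [h%:A]mulr1 [_ *: _](_ : _ = h^-1 * h * a).
      by rewrite mulVf ?mul1r//; near: h; exact: nbhs_dnbhs_neq.
    by rewrite [LHS](_ : _ = h^-1 * (a * (h + x) + b - (a * x + b)))//; ring.
  by split; [apply: cvgP H|exact: cvg_lim H].
apply: (@Ck_cstD _ _ _ _ _ _ _ (fun=> a) _ D) => x.
exact: (is_derive_continuous (D tt x)).
Unshelve. all: by end_near. Qed.

Lemma Ck1_flat k U j : Ck1 k U (flat j).
Proof.
elim: k U j => [|k IH] U j; split => //; try by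
  move=> x _; exact: (is_derive_continuous (is_derive_flat j x)).
move=> _; split.
  by move=> x _; exact: (@ex_derive _ _ _ _ _ _ _ (is_derive_flat j x)).
apply: (@Ck_sub _ _ _ _ k setT) => //.
have -> : 'D_1 (flat j) = (fun x : R => - j%:R * flat j.+1 x) \+ flat j.+2.
  by apply/funext => x; exact: (@derive_val _ _ _ _ _ _ _ (is_derive_flat j x)).
apply: CkD; [exact: openT| |exact: IH].
by apply: CkZ; [exact: openT|exact: IH].
Qed.

Lemma Ck1_powR k (p : R) : Ck1 k [set t : R | 0 < t] (fun t : R => t `^ p).
Proof.
have O : open [set t : R | 0 < t] by exact: open_gt.
elim: k p => [|k IH] p.
  split => // x x0; exact: (is_derive_continuous (is_derive1_powR p x0)).
split; first by move=> x x0; exact: (is_derive_continuous (is_derive1_powR p x0)).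
move=> _; split.
  by move=> x x0; exact: (@ex_derive _ _ _ _ _ _ _ (is_derive1_powR p x0)).
apply: (@Ck_eq _ _ _ _ _ _ (fun t => p * t `^ (p - 1))) => //.
  move=> x; rewrite inE => x0.
  by rewrite -[LHS](@derive_val _ _ _ _ _ _ _ (is_derive1_powR p x0)).
apply: (@CkZ _ _ _ _ _ _ p (fun t : R => t `^ (p - 1))) => //; exact: IH.
Qed.

(** Smooth transition from 0 on t <= 0 to 1 on t >= 1. The denominator never vanishes, as t and 1 -
    t are not both nonpositive. *)
Definition sstep (t : R) : R := flat 0 t / (flat 0 t + flat 0 (1 - t)).

Lemma sstep_den_gt0 (t : R) : 0 < flat 0 t + flat 0 (1 - t).
Proof.
have [t0|t0] := ltP 0 t; first by rewrite ltr_wpDr ?flat_ge0// flat_gt0.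
by rewrite ltr_wpDl ?flat_ge0// flat_gt0// subr_gt0 (le_lt_trans t0).
Qed.

Lemma sstep_le0 t : t <= 0 -> sstep t = 0.
Proof. by move=> t0; rewrite /sstep flat_le0// mul0r. Qed.

Lemma sstep_ge1 t : 1 <= t -> sstep t = 1.
Proof.
move=> t1; rewrite /sstep [X in _ + X]flat_le0 ?subr_le0// addr0 divff//.
by rewrite gt_eqF// flat_gt0// (lt_le_trans _ t1).
Qed.

Lemma sstep_ge0 t : 0 <= sstep t.
Proof. by rewrite divr_ge0 ?flat_ge0// ltW// sstep_den_gt0. Qed.

Lemma sstep_le1 t : sstep t <= 1.
Proof.
by rewrite ler_pdivrMr ?sstep_den_gt0// mul1r lerDl flat_ge0.
Qed.

Lemma Ck1_comp k U U1 F G : open U -> (forall x, U x -> U1 (G x)) ->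
  Ck1 k U1 F -> Ck1 k U G -> Ck1 k U (F \o G).
Proof. exact: Ck_comp. Qed.

Lemma Ck1_sstep k U : open U -> Ck1 k U sstep.
Proof.
move=> oU; apply: CkM => //; first exact: Ck1_flat.
apply: CkV => //.
  by move=> x _; rewrite gt_eqF// sstep_den_gt0.
apply: CkD => //; first exact: Ck1_flat.
rewrite (_ : (fun _ => _) = flat 0 \o (fun t : R => -1 * t + 1)).
  apply: (@Ck1_comp _ _ setT) => //; first exact: Ck1_flat.
  exact: Ck1_affine.
by apply/funext => t /=; rewrite mulN1r addrC.
Qed.

End Ck1.

(** * Smooth functions on R^n: coordinates and the squared norm *)

Section smooth.
Context {R : realType} {n : nat}.
Implicit Types f g phi : 'rV[R]_n -> R.
Local Notation ee := (fun i : 'I_n => delta_mx (0 : 'I_1) i : 'rV[R]_n).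

Lemma partials_rcons s i f : partials (rcons s i) f = partials s ('D_(delta_mx 0 i) f).
Proof. by rewrite /partials foldr_rcons. Qed.

(** [partials] takes the derivative in the last direction of the list first, and [Ck] recurses on
    the derivative taken first; hence the inductions work at the end of the list. *)
Lemma smoothP f : smooth f <-> forall k, Ck ee k setT f.
Proof.
split=> [sf k|Cf s].
  elim: k f sf => [|k IH] f sf; split => //; try by move=> x _; exact: (sf [::]).1.
  move=> i; split; first by move=> x _; exact: (sf [::]).2.
  apply: IH => s; have [c d] := sf (rcons s i).
  by rewrite -!partials_rcons; split.
elim/last_ind: s f Cf => [|s i IH] f Cf.
  split; first by move=> x; apply: (Ck_cont (Cf 0%N)).
  by move=> i x; have [_ /(_ i) [+ _]] := Cf 1%N; apply.
rewrite partials_rcons; apply: IH => k.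
by have [_ /(_ i) []] := Cf k.+1.
Qed.

Lemma smooth_continuous f : smooth f -> continuous f.
Proof. by move=> /(_ [::]) []. Qed.

Lemma smooth_derivable f i x : smooth f -> derivable f x (delta_mx 0 i).
Proof. by move=> /(_ [::]) []. Qed.

Lemma smoothD f g : smooth f -> smooth g -> smooth (f \+ g).
Proof.
move=> /smoothP sf /smoothP sg; apply/smoothP => k; apply: CkD => //; exact: openT.
Qed.

Lemma smoothM f g : smooth f -> smooth g -> smooth (f \* g).
Proof.
move=> /smoothP sf /smoothP sg; apply/smoothP => k; apply: CkM => //; exact: openT.
Qed.

Lemma smooth_partial f i : smooth f -> smooth ('D_(delta_mx 0 i) f).
Proof. by move=> sf s; rewrite -partials_rcons. Qed.

Lemma is_derive_coord (x v : 'rV[R]_n) i :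
  is_derive x v (fun y : 'rV[R]_n => y 0 i) (v 0 i).
Proof.
have H : (fun h : R => h^-1 *: (((fun y : 'rV[R]_n => y 0 i) \o shift x) (h *: v) - x 0 i)) @ 0^' --> v 0 i.
  apply: (@cvg_near_cst _ _ (v 0 i)); near=> h.
  rewrite /= !mxE addrK [_ *: _]mulrA mulVf ?mul1r//.
  by near: h; exact: nbhs_dnbhs_neq.
by split; [apply: cvgP H|exact: cvg_lim H].
Unshelve. all: by end_near. Qed.

Lemma Ck_coord k U i : Ck ee k U (fun x => x 0 i).
Proof.
apply: (@Ck_cstD _ _ _ _ _ _ _ (fun j => (ee j) 0 i)).
  exact: coord_continuous.
by move=> j x; exact: is_derive_coord.
Qed.

(** The square of [enorm]; unlike [enorm] it is smooth at the origin. *)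
Definition sqn (x : 'rV[R]_n) : R := \sum_(i < n) x 0 i ^+ 2.

Lemma sqn_ge0 x : 0 <= sqn x.
Proof. by apply: sumr_ge0 => i _; exact: sqr_ge0. Qed.

Lemma Ck_sqn k U : open U -> Ck ee k U sqn.
Proof.
move=> oU; rewrite (_ : sqn = fun x => \sum_(i <- index_enum 'I_n) (x 0 i * x 0 i)).
  by apply: Ck_sum => // i; apply: CkM => //; exact: Ck_coord.
by apply/funext => x; apply: eq_bigr => i _; rewrite expr2.
Qed.

Lemma is_derive_sqn (x : 'rV[R]_n) j : is_derive x (delta_mx 0 j) sqn (2 * x 0 j).
Proof.
have -> : sqn = \sum_(i < n) (fun y : 'rV[R]_n => y 0 i) ^+ 2.
  by apply/funext => y; rewrite fct_sumE; apply: eq_bigr => i _; rewrite exprfctE.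
have D i : is_derive x (delta_mx 0 j) ((fun y : 'rV[R]_n => y 0 i) ^+ 2) (2 * x 0 j *+ (i == j)).
  apply: is_derive_eq; first by apply: is_deriveX; exact: is_derive_coord.
  rewrite mxE eqxx/= expr1; case: eqVneq => [->|_]; last by rewrite scaler0.
  by rewrite mulr1n [_ *: _]mulr1.
apply: (is_derive_eq (@is_derive_sum _ _ _ _ _ _ _ _ D)).
by rewrite (bigD1 j)//= eqxx mulr1n big1 ?addr0// => i /negPf->.
Qed.

End smooth.

(** * Borel sets of R^n and the fundamental lemma of the calculus of variations *)

Section box.
Context {R : realType} {n : nat}.
Implicit Types (a b c d x : 'rV[R]_n) (U W : set 'rV[R]_n).
Local Notation mu := (@lebesgue_rV R n).

Definition obox a b := [set x : 'rV[R]_n | forall i, a 0 i < x 0 i < b 0 i].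
Definition cbox a b := [set x : 'rV[R]_n | forall i, x 0 i \in `[a 0 i, b 0 i]].

Lemma obox_cbox a b : obox a b `<=` cbox a b.
Proof. by move=> x xab i; have /andP[/ltW ? /ltW ?] := xab i; rewrite in_itv/=; apply/andP. Qed.

Lemma measurable_forall_coor (P : 'I_n -> set R) : (forall i, measurable (P i)) ->
  measurable [set x : 'rV[R]_n | forall i, P i (x 0 i)].
Proof.
move=> mP.
rewrite (_ : [set x | _] = \bigcap_(i in [set: 'I_n])
  ((fun x : 'rV[R]_n => x 0 i : measurableTypeR R) @^-1` (P i))).
  apply: fin_bigcap_measurable => // i _; rewrite -[X in measurable X]setTI.
exact: (@measurable_coor R n i measurableT (P i) (mP i)).
by apply/seteqP; split => x /= h i; [move=> _; exact: h|exact: (h i)].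
Qed.

Lemma measurable_obox a b : measurable (obox a b).
Proof.
rewrite (_ : obox a b = [set x | forall i, [set` `]a 0 i, b 0 i[] (x 0 i)]).
  by apply: (measurable_forall_coor (P := fun i => [set` `]a 0 i, b 0 i[])) => i; exact: measurable_itv.
by apply/seteqP; split => x /= h i; have := h i; rewrite in_itv/=.
Qed.

Lemma measurable_cbox a b : measurable (cbox a b).
Proof. by apply: (measurable_forall_coor (P := fun i => [set` `[a 0 i, b 0 i]])) => i; exact: measurable_itv. Qed.

Lemma compact_cbox a b : compact (cbox a b).
Proof.
apply: (@rV_compact _ n (fun i => `[a 0 i, b 0 i]%classic)) => i.
exact: segment_compact.
Qed.

Lemma closed_cbox a b : closed (cbox a b).
Proof. by apply: compact_closed; [exact: norm_hausdorff|exact: compact_cbox]. Qed.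

(** Enumerates the open boxes with rational corners, padded with empty sets. Asking for the closed
    box to lie in [U] makes functions integrable on it when they are locally integrable on [U], and
    lets bumps on it be test functions. *)
Definition ratbox (U : set 'rV[R]_n) (k : nat) : set 'rV[R]_n :=
  if unpickle k is Some p then
    if `[< cbox (map_mx ratr p.1) (map_mx ratr p.2) `<=` U >]
    then obox (map_mx ratr (p.1 : 'rV[rat]_n)) (map_mx ratr (p.2 : 'rV[rat]_n))
    else set0
  else set0.

Lemma ratboxP U k : ratbox U k = set0 \/
  exists a b, ratbox U k = obox a b /\ cbox a b `<=` U.
Proof.
rewrite /ratbox; case: unpickle => [[p q]|]; last by left.
case: asboolP => h; last by left.
by right; exists (map_mx ratr p), (map_mx ratr q).
Qed.

(** Balls of the sup norm are cubes, so rational corners can be chosen on both sides of each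
    coordinate. This gives measurability of open sets for the product sigma-algebra and reduces
    almost-everywhere statements to countably many boxes. *)
Lemma open_ratboxE U : open U -> U = \bigcup_k ratbox U k.
Proof.
move=> oU; apply/seteqP; split => [x Ux|x [k _]]; last first.
  by have [->//|[a [b [-> abU]]]] := ratboxP U k; move=> /obox_cbox/abU.
have /nbhs_ballP[e /= e0 xeU] : nbhs x U by exact: open_nbhs_nbhs.
have ra i : {r : rat | x 0 i - e < ratr r < x 0 i}.
  by apply/sigW; have [|r] := @rat_in_itvoo _ (x 0 i - e) (x 0 i);
   [rewrite ltrBlDr ltrDl|rewrite in_itv/= => ?; exists r].
have rb i : {r : rat | x 0 i < ratr r < x 0 i + e}.
  by apply/sigW; have [|r] := @rat_in_itvoo _ (x 0 i) (x 0 i + e);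
   [rewrite ltrDl|rewrite in_itv/= => ?; exists r].
pose a : 'rV[rat]_n := \row_i (sval (ra i)).
pose b : 'rV[rat]_n := \row_i (sval (rb i)).
exists (pickle (a, b)) => //; rewrite /ratbox pickleK/= ifT.
  by move=> i; rewrite !mxE; case: (ra i) => ? /= /andP[_ ->]; case: (rb i) => ? /= /andP[->].
apply/asboolP => y yab; apply: xeU; split => // j i.
rewrite ord1 /ball/= ltr_distlC.
have := yab i; rewrite !mxE in_itv/= => /andP[ay yb].
case: (ra i) ay => r /= /andP[h1 h2] h3.
case: (rb i) yb => r' /= /andP[h1' h2'] h3'.
by rewrite (lt_le_trans h1 h3) (le_lt_trans h3' h2').
Qed.

Lemma measurable_ratbox U k : measurable (ratbox U k).
Proof.
by have [->//|[a [b [-> _]]]] := ratboxP U k; exact: measurable_obox.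
Qed.

Lemma open_measurable_rV U : open U -> measurable U.
Proof.
move=> /open_ratboxE ->; apply: bigcup_measurable => k _; exact: measurable_ratbox.
Qed.

Lemma closed_measurable_rV U : closed U -> measurable U.
Proof. by move=> /closed_openC/open_measurable_rV/measurableC; rewrite setCK. Qed.

Lemma continuous_measurable_rV (D : set 'rV[R]_n) (f : 'rV[R]_n -> R) :
  measurable D -> continuous f -> measurable_fun D f.
Proof.
move=> mD /continuousP cf; apply: (@measurable_funS _ _ _ _ setT) => //.
apply: (measurability _ (RGenOpens.measurableE R)).
move=> _ [_ [a [b ->]] <-]; rewrite setTI; apply: open_measurable_rV; apply: cf.
exact: interval_open.
Qed.

Lemma setI_obox a b c d : obox a b `&` obox c d =
  obox (\row_i Num.max (a 0 i) (c 0 i)) (\row_i Num.min (b 0 i) (d 0 i)).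
Proof.
apply/seteqP; split => [x [h1 h2] i|x h].
  have /andP[? ?] := h1 i; have /andP[? ?] := h2 i.
  by rewrite !mxE gt_max lt_min; apply/andP; split; apply/andP.
by split => i; have := h i; rewrite !mxE gt_max lt_min => /andP[/andP[? ?] /andP[? ?]]; apply/andP.
Qed.

Let boxes : set (set 'rV[R]_n) := [set A | exists a b, A = obox a b].

Lemma setI_closed_boxes : setI_closed boxes.
Proof.
by move=> _ _ [a [b ->]] [c [d ->]]; rewrite setI_obox; eexists; eexists.
Qed.

(** The sigma-algebra is generated by the preimages of open intervals under one coordinate, and such
    a slab is the union over [k] of boxes whose other sides are ]-k, k[. *)
Lemma g_sigma_boxes (A : set 'rV[R]_n) : measurable A -> <<s boxes >> A.
Proof.
move: A; pose S := [set A | <<s boxes >> A].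
have S0 : sigma_algebra setT S by exact: smallest_sigma_algebra.
suff : measurable `<=` S by [].
apply: smallest_sub => //.
rewrite -bigcup_seq; apply: bigcup_sub => i _ _ [B mB <-]; rewrite setTI.
pose S' := [set B : set R | S ((fun x : 'rV[R]_n => x 0 i) @^-1` B)].
suff : (@measurable _ (measurableTypeR R)) `<=` S' by apply.
rewrite [X in X `<=` _](RGenOpens.measurableE R).
have [T1 T2 T3] := S0.
apply: smallest_sub.
  split => [|C SC|F SF].
  - by rewrite /S'/= preimage_set0.
  - by rewrite /S'/= setTD preimage_setC -setTD; exact: T2.
  - by rewrite /S'/= preimage_bigcup; exact: T3.
move=> _ [p [q ->]]; rewrite /S'/=.
rewrite (_ : _ @^-1` _ = \bigcup_(k in [set: nat])
   obox (\row_j if j == i then p else - k%:R) (\row_j if j == i then q else k%:R)).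
  apply: T3 => k; apply: sub_sigma_algebra; eexists; eexists; reflexivity.
apply/seteqP; split => [x /= xpq|x [k _] /= /(_ i)]; last by rewrite !mxE eqxx in_itv.
pose M := \sum_(j < n) `|x 0 j|.
exists (Num.truncn M).+1 => // j; rewrite !mxE; case: eqP => [->|_].
  by move: xpq; rewrite in_itv.
rewrite -ltr_norml; apply: (@le_lt_trans _ _ M); last exact: truncnS_gt.
by rewrite /M (bigD1 j)//= lerDl sumr_ge0.
Qed.

End box.

Section integrable_aux.
Context d (T : measurableType d) (R : realType) (mu : {measure set T -> \bar R}).
Variables (D : set T) (mD : measurable D).

Lemma integrable_mulbd (h u : T -> R) (M : R) : measurable_fun D h ->
  (forall x, D x -> `|h x| <= M) -> mu.-integrable D (EFin \o u) ->
  mu.-integrable D (EFin \o (fun x => h x * u x)).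
Proof.
move=> mh hM iu.
have bh : [bounded h x | x in D].
  by exists M; split; [exact: num_real|move=> y My x Dx; apply: le_trans (hM _ Dx) (ltW My)].
exact: (integrableMr mD mh bh iu).
Qed.

End integrable_aux.

(** * Test functions approximating the indicator of a box *)

Section box_bump.
Context {R : realType} {n : nat}.
Implicit Types (c d x : 'rV[R]_n) (W : set 'rV[R]_n).
Local Notation mu := (@lebesgue_rV R n).
Local Notation ee := (fun i : 'I_n => delta_mx (0 : 'I_1) i : 'rV[R]_n).

(** Each factor rises from 0 at a face of the box to 1 at distance 1/(k+1) from it. At a fixed point
    the sequence is therefore eventually equal to the indicator of the open box. *)
Definition box_bump c d (k : nat) x : R :=
  \prod_(i < n) (sstep (k.+1%:R * x 0 i + - k.+1%:R * c 0 i) *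
                 sstep (- k.+1%:R * x 0 i + k.+1%:R * d 0 i)).

Lemma Ck_sstep_affine j U (a b : R) i : open U ->
  Ck ee j U (fun x => sstep (a * x 0 i + b)).
Proof.
move=> oU.
pose F := sstep \o (fun t : R => a * t + b).
have -> : (fun x : 'rV[R]_n => sstep (a * x 0 i + b)) =
  F \o (fun x : 'rV[R]_n => x 0 i) by [].
apply: (@Ck_comp _ _ _ _ _ _ setT) => //; last exact: Ck_coord.
apply: (@Ck1_comp _ _ _ setT) => //; first exact: openT.
  by apply: Ck1_sstep; exact: openT.
exact: Ck1_affine.
Qed.

Lemma smooth_box_bump c d k : smooth (box_bump c d k).
Proof.
apply/smoothP => j; apply: (@Ck_prod _ _ _ ee j setT _ (index_enum 'I_n)); first exact: openT.
by move=> i; apply: CkM; [exact: openT| |]; apply: Ck_sstep_affine; exact: openT.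
Qed.

Lemma box_bump_ge0 c d k x : 0 <= box_bump c d k x.
Proof. by apply: prodr_ge0 => i _; rewrite mulr_ge0 ?sstep_ge0. Qed.

Lemma box_bump_le1 c d k x : box_bump c d k x <= 1.
Proof.
apply: prodr_ile1 => i _; rewrite mulr_ge0 ?sstep_ge0//=.
by rewrite mulr_ile1 ?sstep_ge0 ?sstep_le1.
Qed.

Lemma box_bump_out c d k x : ~ obox c d x -> box_bump c d k x = 0.
Proof.
move=> /existsNP[i /negP]; rewrite negb_and -!leNgt => xi.
rewrite /box_bump (bigD1 i)//=; apply/eqP; rewrite mulf_eq0; apply/orP; left.
rewrite mulf_eq0; apply/orP; case/orP: xi => xi; [left|right]; apply/eqP/sstep_le0.
  by rewrite mulNr -mulrBr pmulr_rle0// subr_le0.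
by rewrite addrC mulNr -mulrBr pmulr_rle0// subr_le0.
Qed.

Lemma cvg_box_bump c d x : box_bump c d k x @[k --> \oo] --> (\1_(obox c d) x : R).
Proof.
have [xcd|xcd] := pselect (obox c d x); last first.
  rewrite indicE memNset//=; apply: (@cvg_near_cst _ _ (0 : R)).
  by near=> k; exact: box_bump_out.
rewrite indicE mem_set//=; apply: (@cvg_near_cst _ _ (1 : R)).
have H (a b : R) : a < b -> \forall k \near \oo, 1 <= k.+1%:R * b + - k.+1%:R * a.
  move=> ab; near=> k; rewrite mulNr -mulrBr -ler_pdivrMr ?subr_gt0//.
  apply: (@le_trans _ _ k%:R); last by rewrite ler_nat.
  by near: k; exact: nbhs_infty_ger.
have H1 : \forall k \near \oo, forall i, 1 <= k.+1%:R * x 0 i + - k.+1%:R * c 0 i.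
  by apply: filter_forall => i; apply: H; have /andP[] := xcd i.
have H2 : \forall k \near \oo, forall i, 1 <= - k.+1%:R * x 0 i + k.+1%:R * d 0 i.
  apply: filter_forall => i; under eq_near do rewrite addrC.
  by apply: H; have /andP[] := xcd i.
near=> k.
have h1 : forall i, 1 <= k.+1%:R * x 0 i + - k.+1%:R * c 0 i by near: k.
have h2 : forall i, 1 <= - k.+1%:R * x 0 i + k.+1%:R * d 0 i by near: k.
by rewrite /box_bump big1// => i _; rewrite !sstep_ge1 ?mulr1//.
Unshelve. all: by end_near. Qed.

Lemma test_box_bump W c d k : cbox c d `<=` W -> test_function W (box_bump c d k).
Proof.
move=> cdW; have sub : closure [set x | box_bump c d k x != 0] `<=` cbox c d.
  rewrite closureE; apply: smallest_sub; first exact: closed_cbox.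
  move=> x /= h; apply: obox_cbox; apply: contrapT => /(@box_bump_out _ _ k)/eqP.
  exact/negP.
split; first exact: smooth_box_bump.
  by apply: subclosed_compact sub; [exact: closed_closure|exact: compact_cbox].
exact: subset_trans cdW.
Qed.

End box_bump.

Section extend.
Context d (T : measurableType d) (R : realType) (mu : {measure set T -> \bar R}).
Variables (D E : set T) (mD : measurable D) (mE : measurable E) (DE : D `<=` E).
Variable f : T -> R.
Hypothesis f0 : forall x, E x -> ~ D x -> f x = 0.

Lemma integral_extend0 : (\int[mu]_(x in E) (f x)%:E = \int[mu]_(x in D) (f x)%:E)%E.
Proof.
rewrite -[in RHS](setIidr DE) integral_mkcondr; apply: eq_integral => x.
rewrite inE => Ex; rewrite patchE; case: ifPn => // /negP; rewrite inE => Dx.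
by rewrite f0.
Qed.

Lemma integrable_extend0 : mu.-integrable D (EFin \o f) -> mu.-integrable E (EFin \o f).
Proof.
rewrite -[in X in X -> _](setIidr DE).
move=> /(integrable_restrict mu mD mE _) H; apply: eq_integrable H => // x.
rewrite inE => Ex; rewrite patchE; case: ifPn => // /negP; rewrite inE => Dx.
by rewrite /= f0.
Qed.

End extend.

(** * Functions orthogonal to all test functions *)

Section fundamental.
Context {R : realType} {n : nat}.
Implicit Types (W D : set 'rV[R]_n) (u phi : 'rV[R]_n -> R).
Local Notation mu := (@lebesgue_rV R n).

Lemma test_out W phi x : test_function W phi ->
  ~ closure [set x | phi x != 0] x -> phi x = 0.
Proof. by move=> _; apply: contra_notP => /eqP h; exact: subset_closure. Qed.

Lemma test_supp0 W phi x : test_function W phi -> ~ W x -> phi x = 0.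
Proof. by move=> [_ _ KW] Wx; apply: contra_notP Wx => /eqP h; apply/KW/subset_closure. Qed.

Lemma continuous_bounded_compact (K : set 'rV[R]_n) phi : continuous phi ->
  compact K -> exists M, forall x, K x -> `|phi x| <= M.
Proof.
move=> cp cK.
have : compact (phi @` K).
  by apply: continuous_compact => //; exact: continuous_subspaceT.
move=> /compact_bounded [M [_ HM]]; exists (M + 1) => x Kx.
by apply: (HM (M + 1)); [rewrite ltrDl|exists x].
Qed.

Lemma test_bounded W phi : test_function W phi -> exists M, forall x, `|phi x| <= M.
Proof.
move=> tp; have [sp cK _] := tp.
have [M HM] := continuous_bounded_compact (smooth_continuous sp) cK.
exists `|M| => x.
have [/HM|/(test_out tp) ->] := pselect (closure [set x | phi x != 0] x).
  by move=> /le_trans; apply; exact: ler_norm.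
by rewrite normr0.
Qed.

Lemma test_mul_integrable W u phi : measurable W -> loc_integrable W u ->
  test_function W phi -> mu.-integrable W (EFin \o (fun x => u x * phi x)).
Proof.
move=> mW [mu_ Iu] tp; have [sp cK KW] := tp.
set K := closure _ in cK KW.
have [M HM] := test_bounded tp.
have mK : measurable K by apply: closed_measurable_rV; exact: closed_closure.
apply: (@integrable_extend0 _ _ _ _ K) => //.
  by move=> x _ /(test_out tp) ->; rewrite mulr0.
have -> : (fun x => u x * phi x) = (fun x => phi x * u x).
  by apply/funext => x; rewrite mulrC.
apply: (@integrable_mulbd _ _ _ _ _ _ _ _ M) => //; last exact: Iu.
by apply: continuous_measurable_rV => //; exact: smooth_continuous.
Qed.

(** Local integrability gives integrability on each box of the countable cover. There, integrals
    over subboxes vanish as limits of integrals against bumps, and an integrable function whose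
    integral over every measurable subset vanishes is 0 almost everywhere. *)
Lemma fundamental_lemma W u : open W -> loc_integrable W u ->
  (forall phi, test_function W phi -> \int[mu]_(x in W) (u x * phi x) = 0) ->
  {ae mu, forall x, W x -> u x = 0}.
Proof.
move=> oW lu H; have mW := open_measurable_rV oW.
suff Hk k : {ae mu, forall x, ratbox W k x -> u x = 0}.
  have : {ae mu, forall x, forall k, ratbox W k x -> u x = 0}.
    exact: ae_foralln.
  apply: filterS => x Hx; rewrite {1}(open_ratboxE oW) => -[k _].
  exact: Hx.
have [->|[a [b [-> abW]]]] := ratboxP W k; first exact: aeW.
pose D := obox a b; have mD : measurable D by exact: measurable_obox.
have DW : D `<=` W by apply: subset_trans abW; exact: obox_cbox.
have iu : mu.-integrable D (EFin \o u).
  apply: (@integrableS _ _ _ _ (cbox a b)) => //; [exact: measurable_cbox|exact: obox_cbox|].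
  by apply: lu.2 => //; exact: compact_cbox.
have muD := measurable_int _ iu.
(* Open boxes form a pi-system, so it suffices that u integrates to 0 on the boxes. *)
suff P S : measurable S -> (\int[mu]_(x in S `&` D) (u x)%:E = 0)%E.
  have := @integral_ae_eq _ _ _ mu D mD (cst 0%E) (EFin \o u) iu (measurable_cst _).
  case; last first.
    move=> N [mN N0 sub]; exists N; split => // x /= h; apply: sub => /= h'.
    by apply: h => Dx; have := h' Dx => -[].
  move=> S SD mS; rewrite integral0 -[RHS](P _ mS).
  by rewrite (setIidl SD).
(* The closure of the intersected box stays in [W], so bumps on it are test functions and integrate
   against [u] to 0. Their values lie in [0, 1], hence |u| dominates. *)
have box0 c e : (\int[mu]_(x in obox c e `&` D) (u x)%:E = 0)%E.
  rewrite setI_obox; set c' := \row_i _; set e' := \row_i _.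
  have sub : obox c' e' `<=` D by rewrite -setI_obox => x [].
  have subc : cbox c' e' `<=` W.
    apply: subset_trans abW => x xc i; have := xc i; rewrite !mxE !in_itv/=.
    by rewrite ge_max le_min => /andP[/andP[_ ->] /andP[_ ->]].
  have [|||||_ _ H1] := @dominated_convergence _ _ _ mu D mD
     (fun k x => (u x * box_bump c' e' k x)%:E) ((EFin \o u) \_ (obox c' e')) (fun x => `|u x|%:E).
  - move=> j; apply/measurable_EFinP; apply: measurable_funM.
      by apply/measurable_EFinP.
    by apply: continuous_measurable_rV => //; apply: smooth_continuous; exact: smooth_box_bump.
  - apply/(measurable_restrict _ (measurable_obox _ _)) => //.
    by apply: measurable_funS muD => // x [].
  - apply: aeW => x Dx; rewrite (_ : _ x = (u x * \1_(obox c' e') x)%:E).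
      by apply: cvg_EFin; [exact: nearW|apply: cvgMr; exact: cvg_box_bump].
    by rewrite patchE indicE; case: ifPn; rewrite ?mulr1 ?mulr0.
  - exact: integrable_abse iu.
  - apply: aeW => x j Dx /=; rewrite lee_fin normrM ler_piMr//.
    by rewrite ger0_norm ?box_bump_ge0 ?box_bump_le1.
  rewrite -[X in integral _ X](setIidr sub) integral_mkcondr.
  apply: cvg_unique H1 _ => //.
  rewrite [X in X @ _](_ : _ = cst 0%E); first exact: cvg_cst.
  apply/funext => j /=.
  have tb := test_box_bump j subc.
  rewrite -(integral_extend0 _ DW); last first.
    move=> x _ Dx; rewrite box_bump_out ?mulr0// => /sub; exact: Dx.
  have /(integrable_fin_num mW)/fineK <- := test_mul_integrable mW lu tb.
  by have := H _ tb; rewrite /Rintegral => ->.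
move=> mS.
have G : @measurable _ 'rV[R]_n = <<s [set A | exists c e : 'rV[R]_n, A = obox c e] >>.
  apply/seteqP; split => [A|]; first exact: g_sigma_boxes.
  apply: smallest_sub; first exact: sigma_algebra_measurable.
  by move=> B [c' [e' BE]]; rewrite BE; exact: measurable_obox.
have D0 : (\int[mu]_(x in D) (u x)%:E = 0)%E by rewrite -[D]setIid; exact: box0.
apply: (@dynkin_induction _ _ _ (fun S => (\int[mu]_(x in S `&` D) (u x)%:E = 0)%E) G); last by rewrite -G.
- exact: setI_closed_boxes.
- by rewrite setTI.
- by move=> B [c' [e' BE]]; rewrite BE; exact: box0.
- move=> A mA A0.
  have := D0; rewrite -[in X in integral _ X](setTI D) -(setvU A) setIUl.
  rewrite integral_setU//; try exact: measurableI.
  + by rewrite A0 adde0.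
  + by apply: measurableI => //; exact: measurableC.
  + by rewrite -setIUl setvU setTI.
  + by apply/disj_set2P; rewrite setIACA setICl set0I.
- move=> F mF tF F0; rewrite setI_bigcupl integral_bigcup.
  + by rewrite eseries0.
  + by apply: trivIset_setIr.
  + by move=> i; exact: measurableI.
  + by rewrite -setI_bigcupl; apply: integrableS iu => //; apply: measurableI => //; exact: bigcup_measurable.
Qed.

End fundamental.

(** * Slicing, the divergence theorem and weak derivatives *)

Section slice.
Context {R : realType} {n : nat}.
Local Notation leb := (@lebesgue_measure R).
Local Notation mu := (@lebesgue_rV R n).

Lemma ge0_integral_cons (f : 'rV[R]_n.+1 -> \bar R) :
  measurable_fun setT f -> (forall x, 0 <= f x)%E ->
  (\int[@lebesgue_rV R n.+1]_x f x = \int[leb]_t \int[mu]_y f (cons_rV (t, y)))%E.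
Proof.
move=> mf f0.
have mcf : measurable_fun setT (f \o cons_rV) by apply: measurableT_comp => //; exact: measurable_cons_rV.
transitivity (\int[leb \x mu]_z (f \o cons_rV) z)%E.
  have := @ge0_integral_pushforward _ _ _ _ R cons_rV measurable_cons_rV
    (leb \x mu)%E setT f measurableT mf (fun y _ => f0 y).
  by rewrite preimage_setT.
rewrite (@fubini_tonelli1 _ _ _ _ _ leb mu (f \o cons_rV) mcf)//.
by move=> ? ; exact: f0.
Qed.

Section integrable.
Variable f : 'rV[R]_n.+1 -> R.
Hypothesis mf : measurable_fun setT f.
Hypothesis intf : (@lebesgue_rV R n.+1).-integrable setT (EFin \o f).

Let mcf : measurable_fun setT (EFin \o f \o cons_rV).
Proof.
apply: measurableT_comp; first exact/measurable_EFinP.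
exact: measurable_cons_rV.
Qed.

Let intcf : (leb \x mu)%E.-integrable setT (EFin \o f \o cons_rV).
Proof.
apply/integrableP; split => //.
have /integrableP[_] := intf.
have := @ge0_integral_pushforward _ _ _ _ R cons_rV measurable_cons_rV
    (leb \x mu)%E setT (fun x => `|(f x)%:E|)%E measurableT.
rewrite preimage_setT => <- //.
by apply: measurableT_comp => //; exact/measurable_EFinP.
Qed.

Let integralE : (\int[@lebesgue_rV R n.+1]_x (f x)%:E =
  \int[leb \x mu]_z (EFin \o f \o cons_rV) z)%E.
Proof.
have := @integral_pushforward _ _ _ _ R cons_rV measurable_cons_rV
  (leb \x mu)%E setT (EFin \o f).
rewrite preimage_setT; apply => //; exact/measurable_EFinP.
Qed.

Lemma integral_cons12 :
  (\int[@lebesgue_rV R n.+1]_x (f x)%:E = \int[leb]_t \int[mu]_y (f (cons_rV (t, y)))%:E)%E.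
Proof. by rewrite integralE -integral12_prod_meas1. Qed.

Lemma integral_cons21 :
  (\int[@lebesgue_rV R n.+1]_x (f x)%:E = \int[mu]_y \int[leb]_t (f (cons_rV (t, y)))%:E)%E.
Proof. by rewrite integralE -integral21_prod_meas1. Qed.

End integrable.
End slice.

Section divergence.
Context {R : realType}.
Local Notation mu := (@lebesgue_rV R _).

(** A bound on coordinates passes directly to the slices used in the induction on the dimension. *)
Definition bounded_supp n (M : R) (f : 'rV[R]_n -> R) :=
  forall x : 'rV[R]_n, (exists j, M < `|x 0 j|) -> f x = 0.

Lemma lebesgue_cbox_fin n (a b : 'rV[R]_n) : (mu (cbox a b) < +oo)%E.
Proof.
apply: (@le_lt_trans _ _ (mu (cbox (\row_i Num.min (a 0 i) (b 0 i)) (\row_i Num.max (a 0 i) (b 0 i))))).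
  apply: le_measure; rewrite ?inE; try exact: measurable_cbox.
  move=> x xab i; have := xab i; rewrite !in_itv/= !mxE => /andP[h1 h2].
  by rewrite ge_min h1/= le_max h2 orbT.
rewrite lebesgue_rV_box ?ltry// => i; rewrite !mxE.
by rewrite (@le_trans _ _ (a 0 i))// ?ge_min ?le_max lexx.
Qed.

Lemma integrable_bounded_supp n (M : R) (f : 'rV[R]_n -> R) : continuous f ->
  bounded_supp M f -> mu.-integrable setT (EFin \o f).
Proof.
move=> cf fM; set K : set 'rV[R]_n := cbox (const_mx (- M)) (const_mx M).
have mK : measurable K by exact: measurable_cbox.
apply: (@integrable_extend0 _ _ _ _ K) => //.
  move=> x _ /existsNP[j]; rewrite in_itv/= !mxE -ler_norml => /negP.
  by rewrite -ltNge => Mj; apply: fM; exists j.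
have [B HB] := continuous_bounded_compact cf (@compact_cbox _ _ (const_mx (- M)) (const_mx M)).
apply: measurable_bounded_integrable => //; first exact: lebesgue_cbox_fin.
  exact: continuous_measurable_rV.
by exists B; split; [exact: num_real|move=> y By x Kx; apply: le_trans (HB _ Kx) (ltW By)].
Qed.

Lemma bounded_supp_derive n (M : R) (f : 'rV[R]_n -> R) v :
  bounded_supp M f -> bounded_supp M ('D_v f).
Proof.
move=> fM x [j xj]; rewrite -(@derive_cst _ _ _ (0 : R) x v).
apply: near_eq_derive; near=> y; apply: fM; exists j; near: y.
have : {for x, continuous (fun y : 'rV[R]_n => `|y 0 j|)}.
  by apply: continuous_comp; [exact: coord_continuous|exact: norm_continuous].
by move=> /(cvgr_gt _); apply.
Unshelve. all: by end_near. Qed.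

Lemma cons_rV_lin0 n (t : R) (y : 'rV[R]_n) :
  cons_rV (t, y) = t *: delta_mx 0 ord0 + cons_rV (0, y).
Proof.
apply/rowP => i; rewrite !mxE eqxx/=; case: (unliftP ord0 i) => [j|] ->.
  by rewrite (_ : (lift _ _ == _) = false)// mulr0 add0r.
by rewrite eqxx mulr1 addr0.
Qed.

Lemma cons_rV_linS n (h t : R) (j : 'I_n) (y : 'rV[R]_n) :
  cons_rV (t, h *: delta_mx 0 j + y) = h *: delta_mx 0 (lift ord0 j) + cons_rV (t, y).
Proof.
apply/rowP => i; rewrite !mxE eqxx/=; case: (unliftP ord0 i) => [k|] ->.
  by rewrite !mxE eqxx/= (inj_eq (@lift_inj _ ord0)).
by rewrite (_ : (ord0 == _) = false)// mulr0 add0r.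
Qed.

Lemma continuous_cons_rVl n (y : 'rV[R]_n) : continuous (fun t : R => cons_rV (t, y)).
Proof.
under eq_fun do rewrite cons_rV_lin0.
by move=> t; apply: cvgD; [apply: cvgZr_tmp; exact: cvg_id|exact: cvg_cst].
Qed.

Lemma continuous_cons_rVr n (t : R) : continuous (fun y : 'rV[R]_n => cons_rV (t, y)).
Proof.
move=> y A /nbhs_ballP[e /= e0 He].
apply: (filterS _ (nbhsx_ballx y e e0)) => z [_ yz]; apply: He.
split => // i0 i; rewrite ord1.
case: (unliftP ord0 i) => [j|] ->; last by rewrite !cons_rV0; exact: ballxx.
rewrite !cons_rVS.
exact: yz.
Qed.

Lemma integral_derive0_R (M : R) (h : R -> R) : (forall x, derivable h x 1) ->
  continuous ('D_1 h) -> (forall t, M < `|t| -> h t = 0) ->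
  (\int[lebesgue_measure]_t ('D_1 h t)%:E = 0)%E.
Proof.
move=> dh ch hM.
(* Positive even when [M] is negative, so that the interval of the fundamental theorem of calculus
   is not degenerate. *)
pose N := `|M| + 1.
have N0 : 0 < N by rewrite ltr_wpDl.
have MN : M < N by rewrite /N ltr_pwDr// ler_norm.
have hN t : N <= `|t| -> h t = 0 by move=> Nt; apply: hM; exact: lt_le_trans Nt.
have dhN t : N < `|t| -> 'D_1 h t = 0.
  move=> Nt; rewrite -(@derive_cst _ _ _ (0 : R) t 1).
  apply: near_eq_derive; near=> s; apply: hM; near: s.
  by apply: (cvgr_gt _ (@norm_continuous _ _ t)); exact: lt_trans Nt.
rewrite (@integral_extend0 _ (measurableTypeR R) R lebesgue_measure `[- N, N]%classic setT _ ('D_1 h))//; last first.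
  by move=> t _ /= /negP; rewrite in_itv/= -ler_norml -ltNge; exact: dhN.
rewrite (@continuous_FTC2 _ _ h)//.
- by rewrite !hN ?subee// ?normrN ger0_norm// ltW.
- by rewrite -subr_gt0 opprK addr_gt0.
- by apply: continuous_subspaceT.
- have hc : continuous h by move=> x; apply: differentiable_continuous; exact/derivable1_diffP.
  split => //.
  + by apply: cvg_at_right_filter; exact: hc.
  + by apply: cvg_at_left_filter; exact: hc.
- by move=> x _; rewrite derive1E.
Unshelve. all: by end_near. Qed.

(** Induction on the dimension. For a direction other than the first, the first coordinate is frozen
    and the induction hypothesis applies to the slice. For the first direction, the first coordinate
    is integrated innermost, by the fundamental theorem of calculus. *)
Lemma integral_derive0 n (M : R) (i : 'I_n) (f : 'rV[R]_n -> R) :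
  (forall x, derivable f x (delta_mx 0 i)) ->
  continuous ('D_(delta_mx 0 i) f) -> bounded_supp M f ->
  (\int[mu]_x ('D_(delta_mx 0 i) f x)%:E = 0)%E.
Proof.
elim: n i f => [[]//|n IH] i f df cf fM.
have ig := integrable_bounded_supp cf (bounded_supp_derive _ fM).
have mg := continuous_measurable_rV measurableT cf.
case: (unliftP ord0 i) => [j ij|i0].
  rewrite (integral_cons12 mg ig); apply: integral0_eq => t _.
  have E y : 'D_(delta_mx 0 j) (fun y => f (cons_rV (t, y))) y =
             'D_(delta_mx 0 i) f (cons_rV (t, y)).
    by rewrite derive_line [RHS]derive_line; congr (derive _ _ _); apply/funext => h; rewrite cons_rV_linS ij.
  under eq_integral do rewrite -E.
  apply: IH.
  - move=> y; apply: (derivable1P _ _ _).2.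
    have := (derivable1P _ _ _).1 (df (cons_rV (t, y))).
    suff -> : (fun h : R => f (cons_rV (t, h *: delta_mx 0 j + y))) =
      (fun h : R => f (h *: delta_mx 0 i + cons_rV (t, y))) by [].
    by apply/funext => h; rewrite cons_rV_linS ij.
  - rewrite (_ : 'D_(delta_mx 0 j) _ = 'D_(delta_mx 0 i) f \o (fun y => cons_rV (t, y))).
      move=> y; apply: continuous_comp; last exact: cf.
      exact: continuous_cons_rVr.
    by apply/funext => y; rewrite E.
  - by move=> y [k Mk]; apply: fM; exists (lift ord0 k); rewrite cons_rVS.
rewrite (integral_cons21 mg ig); apply: integral0_eq => y _.
pose h t := f (cons_rV (t, y)).
have L t s : s%:A + t = s + t :> R by rewrite [s%:A]mulr1.
have E t : 'D_1 h t = 'D_(delta_mx 0 i) f (cons_rV (t, y)).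
  rewrite derive_line [RHS]derive_line; congr (derive _ _ _); apply/funext => s.
  by rewrite /h L cons_rV_lin0 scalerDl -addrA -cons_rV_lin0 i0.
under eq_integral do rewrite -E.
apply: (@integral_derive0_R M).
- move=> t; apply: (derivable1P _ _ _).2.
  have := (derivable1P _ _ _).1 (df (cons_rV (t, y))).
  suff -> : (fun s : R => h (s *: 1 + t)) =
    (fun s : R => f (s *: delta_mx 0 i + cons_rV (t, y))) by [].
  by apply/funext => s; rewrite /h L cons_rV_lin0 scalerDl -addrA -cons_rV_lin0 i0.
- rewrite (_ : 'D_1 h = 'D_(delta_mx 0 i) f \o (fun t => cons_rV (t, y))).
    move=> t; apply: continuous_comp; last exact: cf.
    exact: continuous_cons_rVl.
  by apply/funext => t; rewrite E.
- by move=> t Mt; apply: fM; exists ord0; rewrite cons_rV0.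
Qed.

End divergence.

(** * Weak derivatives: uniqueness and test functions *)

Section weak.
Context {R : realType} {n : nat}.
Implicit Types (W : set 'rV[R]_n) (u v phi : 'rV[R]_n -> R) (i : 'I_n).
Local Notation mu := (@lebesgue_rV R n).

Lemma weak_partials_unique W s u v1 v2 : open W ->
  weak_partials W s u v1 -> weak_partials W s u v2 ->
  {ae mu, forall x, W x -> v1 x = v2 x}.
Proof.
move=> oW [_ l1 H1] [_ l2 H2]; have mW := open_measurable_rV oW.
have l12 : loc_integrable W (fun x => v1 x - v2 x).
  split; first by apply: measurable_funB; [exact: l1.1|exact: l2.1].
  move=> K cK KW.
  have mK : measurable K by apply: closed_measurable_rV; apply: compact_closed cK; exact: norm_hausdorff.
  exact: (integrableB mK (l1.2 K cK KW) (l2.2 K cK KW)).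
have := fundamental_lemma oW l12.
move=> H; have {}H : {ae mu, forall x, W x -> v1 x - v2 x = 0}.
  apply: H => phi tp.
  have i1 := test_mul_integrable mW l1 tp.
  have i2 := test_mul_integrable mW l2 tp.
  under eq_Rintegral do rewrite mulrBl.
  rewrite RintegralB//; apply/eqP; rewrite subr_eq0; apply/eqP.
  have s0 : (-1) ^+ size s != 0 :> R by rewrite signr_eq0.
  by apply: (mulfI s0); rewrite -H1// -H2.
by apply: filterS H => x Hx /Hx/eqP; rewrite subr_eq0 => /eqP.
Qed.

Lemma wpartialsP W s u v : open W -> weak_partials W s u v ->
  weak_partials W s u (wpartials W s u) /\
  {ae mu, forall x, W x -> wpartials W s u x = v x}.
Proof.
move=> oW H; have H' : weak_partials W s u (wpartials W s u).
  by apply: (@xgetPex _ (cst 0) [set v | weak_partials W s u v]); exists v.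
by split => //; exact: weak_partials_unique H' H.
Qed.

Lemma test_partial W phi i : test_function W phi ->
  test_function W ('D_(delta_mx 0 i) phi).
Proof.
move=> tp; have [sp cK KW] := tp.
have sub : closure [set x | 'D_(delta_mx 0 i) phi x != 0] `<=` closure [set x | phi x != 0].
  rewrite [X in X `<=` _]closureE; apply: smallest_sub; first exact: closed_closure.
  move=> x /=; apply: contra_neqP => nx.
  rewrite -(@derive_cst _ _ _ (0 : R) x (delta_mx 0 i)); apply: near_eq_derive.
  have : nbhs x (~` closure [set x | phi x != 0]).
    by apply: open_nbhs_nbhs; split => //; apply: closed_openC; exact: closed_closure.
  by apply: filterS => y /(test_out tp).
split; first exact: smooth_partial.
  by apply: subclosed_compact sub; [exact: closed_closure|].
exact: subset_trans KW.
Qed.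

Lemma test_mul W phi f : smooth f -> test_function W phi -> test_function W (phi \* f).
Proof.
move=> sf tp; have [sp cK KW] := tp.
have sub : closure [set x | (phi \* f) x != 0] `<=` closure [set x | phi x != 0].
  by apply: closure_subset => x /=; apply: contra_neq => ->; rewrite mul0r.
split; first exact: smoothM.
  by apply: subclosed_compact sub; [exact: closed_closure|].
exact: subset_trans KW.
Qed.

Lemma test_bounded_supp W phi : test_function W phi -> exists M, bounded_supp M phi.
Proof.
move=> tp; have [sp cK KW] := tp.
have [M [_ HM]] := compact_bounded cK.
exists (M + 1) => x [j Mj]; apply: (test_out tp) => Kx.
have := HM (M + 1); rewrite ltrDl ltr01 => /(_ isT x Kx) /= xM.
move: Mj; rewrite ltNge; apply/negP; rewrite negbK; apply: le_trans xM.
by rewrite [leRHS]/Num.norm/= mx_normrE; apply: (le_bigmax _ (fun ij : 'I_1 * 'I_n => `|x ij.1 ij.2|) (0, j)).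
Qed.

Lemma Rintegral_test_partial W phi i : open W -> test_function W phi ->
  \int[mu]_(x in W) ('D_(delta_mx 0 i) phi x) = 0.
Proof.
move=> oW tp; have [sp _ _] := tp; have [M bM] := test_bounded_supp tp.
rewrite /Rintegral -(@integral_extend0 _ _ _ _ W setT)//.
  have c := smooth_continuous (smooth_partial i sp).
  by rewrite (integral_derive0 (fun x => smooth_derivable sp) c bM).
by move=> x _ Wx; exact: (test_supp0 (test_partial i tp) Wx).
Qed.

Lemma derive_mul phi f i x : smooth phi -> smooth f ->
  'D_(delta_mx 0 i) (phi \* f) x =
  'D_(delta_mx 0 i) phi x * f x + phi x * 'D_(delta_mx 0 i) f x.
Proof.
move=> sp sf; rewrite [LHS]deriveM; [|exact: smooth_derivable..].
by rewrite addrC; congr (_ + _); rewrite [LHS]mulrC.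
Qed.

Lemma test_integrable W phi : test_function W phi -> mu.-integrable setT (EFin \o phi).
Proof.
move=> tp; have [sp _ _] := tp; have [M bM] := test_bounded_supp tp.
by apply: integrable_bounded_supp bM; exact: smooth_continuous.
Qed.

Lemma Rintegral_test_parts W phi f i : open W -> smooth f -> test_function W phi ->
  \int[mu]_(x in W) (f x * 'D_(delta_mx 0 i) phi x) =
  - \int[mu]_(x in W) ('D_(delta_mx 0 i) f x * phi x).
Proof.
move=> oW sf tp; have [sp _ _] := tp; have mW := open_measurable_rV oW.
have := Rintegral_test_partial i oW (test_mul sf tp).
under eq_Rintegral do rewrite derive_mul//.
have I g psi : smooth g -> test_function W psi ->
    mu.-integrable W (EFin \o (fun x => g x * psi x)).
  move=> sg tpsi; apply: (@integrableS _ _ _ _ setT) => //.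
  have -> : (fun x => g x * psi x) = psi \* g by apply/funext => x; rewrite mulrC.
  exact: test_integrable (test_mul sg tpsi).
rewrite RintegralD//.
- move=> /eqP; rewrite addr_eq0 => /eqP E.
  transitivity (\int[mu]_(x in W) ('D_(delta_mx 0 i) phi x * f x)).
    by apply: eq_Rintegral => x _; rewrite mulrC.
  by rewrite E; congr (- _); apply: eq_Rintegral => x _; rewrite mulrC.
- have := I f _ sf (test_partial i tp).
  by congr (_.-integrable _ _); apply/funext => x /=; rewrite mulrC.
- have := I _ _ (smooth_partial i sf) tp.
  by congr (_.-integrable _ _); apply/funext => x /=; rewrite mulrC.
Qed.

Lemma continuous_loc_integrable W f : measurable W -> continuous f -> loc_integrable W f.
Proof.
move=> mW cf; split; first exact: continuous_measurable_rV.
move=> K cK KW; have [M HM] := continuous_bounded_compact cf cK.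
have mK : measurable K by apply: closed_measurable_rV; apply: compact_closed cK; exact: norm_hausdorff.
apply: measurable_bounded_integrable => //.
- have [N [_ HN]] := compact_bounded cK.
  apply: le_lt_trans (lebesgue_cbox_fin (const_mx (- (N + 1))) (const_mx (N + 1)) : (mu _ < _)%E).
  apply: le_measure; rewrite ?inE//; first exact: measurable_cbox.
  move=> x Kx j; rewrite in_itv/= !mxE -ler_norml.
  have := HN (N + 1); rewrite ltrDl ltr01 => /(_ isT x Kx); apply: le_trans.
  by rewrite [leRHS]/Num.norm/= mx_normrE; apply: (le_bigmax _ (fun ij : 'I_1 * 'I_n => `|x ij.1 ij.2|) (0, j)).
- exact: continuous_measurable_rV.
- by exists M; split; [exact: num_real|move=> y My x Kx; apply: le_trans (HM _ Kx) (ltW My)].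
Qed.

End weak.

(** * Limits of quadratic integrals *)

Section sqint.
Context d (T : measurableType d) (R : realType) (mu : {measure set T -> \bar R}).
Variables (D : set T) (mD : measurable D).
Implicit Types f g h : T -> R.

Definition sqint f := measurable_fun D f /\
  (\int[mu]_(x in D) (f x ^+ 2)%:E < +oo)%E.

Lemma sqint_measurable f : sqint f -> measurable_fun D f. Proof. by case. Qed.

Lemma sqint_integrable f : sqint f -> mu.-integrable D (EFin \o (fun x => f x ^+ 2)).
Proof.
move=> [mf f2]; apply/integrableP; split.
  by apply/measurable_EFinP; apply: measurable_funX.
rewrite (eq_integral (fun x => (f x ^+ 2)%:E))// => x _ /=.
by rewrite ger0_norm ?sqr_ge0.
Qed.

Lemma integrable_le f g : measurable_fun D f -> mu.-integrable D (EFin \o g) ->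
  (forall x, D x -> `|f x| <= g x) -> mu.-integrable D (EFin \o f).
Proof.
move=> mf ig fg; apply: le_integrable ig => //; first exact/measurable_EFinP.
by move=> x Dx; rewrite /= lee_fin (le_trans (fg x Dx))// ler_norm.
Qed.

Lemma integrable_sqP f : measurable_fun D f ->
  mu.-integrable D (EFin \o (fun x => f x ^+ 2)) -> sqint f.
Proof.
move=> mf /integrableP[_ H]; split => //; move: H.
rewrite (eq_integral (fun x => (f x ^+ 2)%:E))// => x _ /=.
by rewrite ger0_norm ?sqr_ge0.
Qed.

Lemma sqint_mul f g : sqint f -> sqint g ->
  mu.-integrable D (EFin \o (fun x => f x * g x)).
Proof.
move=> lf lg; apply: (@integrable_le _ (fun x => f x ^+ 2 + g x ^+ 2)).
- by apply: measurable_funM; exact: sqint_measurable.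
- exact: (integrableD mD (sqint_integrable lf) (sqint_integrable lg)).
- move=> x Dx; rewrite normrM.
  have := sqr_ge0 (`|f x| - `|g x|).
  rewrite -(real_normK (num_real (f x))) -(real_normK (num_real (g x))).
  by have := normr_ge0 (f x); have := normr_ge0 (g x); nra.
Qed.

Lemma sqintB f g : sqint f -> sqint g -> sqint (fun x => f x - g x).
Proof.
move=> lf lg; apply: integrable_sqP.
  by apply: measurable_funB; exact: sqint_measurable.
apply: (@integrable_le _ (fun x => 2 * f x ^+ 2 + 2 * g x ^+ 2)).
- by apply: measurable_funX; apply: measurable_funB; exact: sqint_measurable.
- exact: (integrableD mD (integrableZl mD 2 (sqint_integrable lf)) (integrableZl mD 2 (sqint_integrable lg))).
- move=> x Dx; rewrite ger0_norm ?sqr_ge0//.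
  by have := sqr_ge0 (f x + g x); lra.
Qed.

Lemma sqint_mulbd (M : R) h f : measurable_fun D h -> (forall x, D x -> `|h x| <= M) ->
  sqint f -> sqint (fun x => h x * f x).
Proof.
move=> mh hM lf; apply: integrable_sqP.
  by apply: measurable_funM => //; exact: sqint_measurable.
under eq_fun do rewrite exprMn.
apply: (@integrable_mulbd _ _ _ _ _ _ _ _ (M ^+ 2)) => //.
- by apply: measurable_funX.
- by move=> x Dx; rewrite normrX ler_pXn2r ?nnegrE ?hM// (le_trans _ (hM x Dx)).
- exact: sqint_integrable.
Qed.

Lemma sqint_ae f g : measurable_fun D g ->
  {ae mu, forall x, D x -> g x = f x} -> sqint f -> sqint g.
Proof.
move=> mg gf [mf f2]; split => //.
rewrite (@ae_eq_integral _ _ _ _ D (fun x => (f x ^+ 2)%:E))//.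
- by apply/measurable_EFinP; apply: measurable_funX.
- by apply/measurable_EFinP; apply: measurable_funX.
- by apply: filterS gf => x /= h /h ->.
Qed.

Lemma sqint_bounded (M : R) f : (mu D < +oo)%E -> measurable_fun D f ->
  (forall x, D x -> `|f x| <= M) -> sqint f.
Proof.
move=> Doo mf fM; apply: integrable_sqP => //.
apply: measurable_bounded_integrable => //; first exact: measurable_funX.
exists (M ^+ 2); split; [exact: num_real|move=> y My x Dx].
apply: le_trans (ltW My).
by rewrite normrX ler_pXn2r ?nnegrE ?fM// (le_trans _ (fM x Dx)).
Qed.

Lemma sqint_sum (I : Type) (s : seq I) (F : I -> T -> R) : (mu D < +oo)%E ->
  (forall i, sqint (F i)) -> sqint (fun x => \sum_(i <- s) F i x).
Proof.
move=> Doo lF; elim: s => [|i s IH].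
  rewrite (_ : (fun _ => _) = cst 0); last by apply/funext => x; rewrite big_nil.
  by apply: (@sqint_bounded 0) => // x _; rewrite normr0.
rewrite (_ : (fun _ => _) = fun x => F i x - (fun x => -1 * \sum_(j <- s) F j x) x); last first.
  by apply/funext => x; rewrite big_cons mulN1r opprK.
apply: sqintB => //; apply: (@sqint_mulbd 1 (cst (-1))) => //.
by move=> x _; rewrite normrN normr1.
Qed.

(** Pairing with a fixed square integrable [g] is continuous for L^2 convergence; this carries
    identities from test functions over to their limits. *)
Lemma cvg_Rintegral_mul (f_ : nat -> T -> R) f g : (forall j, sqint (f_ j)) ->
  sqint f -> sqint g ->
  ((fun j => \int[mu]_(x in D) ((f_ j x - f x) ^+ 2)%:E) @ \oo --> 0)%E ->
  \int[mu]_(x in D) (f_ j x * g x) @[j --> \oo] --> \int[mu]_(x in D) (f x * g x).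
Proof.
move=> lf_ lf lg cf.
have lB j := sqintB (lf_ j) lf.
pose A j := \int[mu]_(x in D) ((f_ j x - f x) ^+ 2).
have cA : A j @[j --> \oo] --> (0 : R).
  exact: (fine_cvg cf).
pose G := \int[mu]_(x in D) (g x ^+ 2).
have G0 : 0 <= G by apply: Rintegral_ge0 => x _; exact: sqr_ge0.
(* Young's inequality with a free parameter c replaces Cauchy-Schwarz. *)
have key (c : R) j : 0 < c ->
  `|\int[mu]_(x in D) (f x * g x) - \int[mu]_(x in D) (f_ j x * g x)| <= c^-1 * A j + c * G.
  move=> c0; rewrite distrC -RintegralB//; try exact: sqint_mul.
  have E : (fun x => f_ j x * g x - f x * g x) = (fun x => (f_ j x - f x) * g x).
    by apply/funext => x; rewrite mulrBl.
  rewrite E; have ip := sqint_mul (lB j) lg.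
  apply: (le_trans (le_normr_Rintegral mD ip)).
  have i1 : mu.-integrable D (EFin \o (fun x => c^-1 * (f_ j x - f x) ^+ 2)).
    exact: (integrableZl mD c^-1 (sqint_integrable (lB j))).
  have i2 : mu.-integrable D (EFin \o (fun x => c * g x ^+ 2)).
    exact: (integrableZl mD c (sqint_integrable lg)).
  rewrite /A /G -!RintegralZl//; try exact: sqint_integrable.
  rewrite -RintegralD//; apply: le_Rintegral => //.
  - exact: (integrable_norm ip).
  - exact: (integrableD mD i1 i2).
  - move=> x Dx; rewrite normrM; set a := f_ j x - f x; set b := g x.
    rewrite -(real_normK (num_real a)) -(real_normK (num_real b)).
    rewrite -(ler_pM2l c0) mulrDr mulVKf ?gt_eqF//.
    by have := sqr_ge0 (`|a| - c * `|b|); have := normr_ge0 a; have := normr_ge0 b; nra.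
apply/cvgrPdist_le => e e0.
(* Keeps the part c G of the bound below e/2; G + 1 avoids a division by zero. With [c] fixed, the
   part with [A j] falls below e/2 for large [j]. *)
pose c := e / (2 * (G + 1)).
have c0 : 0 < c by rewrite divr_gt0// mulr_gt0// ltr_wpDl.
have cG : c * G <= e / 2.
  rewrite /c mulrAC ler_pdivrMr; last by rewrite mulr_gt0// ltr_wpDl.
  by nra.
near=> j; apply: (le_trans (key c j c0)).
rewrite [leRHS]splitr lerD// mulrC ler_pdivrMr//.
apply: (le_trans (ler_norm _)); near: j.
have := cvgr0_norm_le _ cA; apply.
by rewrite mulr_gt0// divr_gt0.
Unshelve. all: by end_near. Qed.

End sqint.

(** * The Rellich inequality on H^2 \cap H^1_0 *)

Section pw.
Context {R : realType} {n : nat}.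
Implicit Types (x : 'rV[R]_n) (i : 'I_n).
Local Notation ee := (fun i : 'I_n => delta_mx (0 : 'I_1) i : 'rV[R]_n).

(* Regularized power weight: |x|^(2p) corresponds to e = 0. *)
Definition pw (e p : R) x : R := (sqn x + e) `^ p.

Lemma sqnD_gt0 e x : 0 < e -> 0 < sqn x + e.
Proof. by move=> e0; rewrite ltr_wpDl// sqn_ge0. Qed.

Lemma pw_gt0 e p x : 0 < e -> 0 < pw e p x.
Proof. by move=> e0; rewrite powR_gt0// sqnD_gt0. Qed.

Lemma pwS e p x : 0 < e -> pw e (p + 1) x = pw e p x * (sqn x + e).
Proof.
by move=> e0; rewrite /pw powRD ?powRr1 ?ltW ?sqnD_gt0// (gt_eqF (sqnD_gt0 x e0)) implybT.
Qed.

Lemma smooth_pw e p : 0 < e -> smooth (pw e p).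
Proof.
move=> e0; apply/smoothP => k.
rewrite (_ : pw e p = (fun t : R => t `^ p) \o (sqn \+ cst e))//.
apply: (@Ck_comp _ _ _ _ _ _ [set t : R | 0 < t]); first exact: openT.
- by move=> x _; exact: sqnD_gt0.
- exact: Ck1_powR.
- by apply: CkD; [exact: openT|apply: Ck_sqn; exact: openT|exact: Ck_cst].
Qed.

Lemma smooth_coord i : smooth (fun x : 'rV[R]_n => x 0 i).
Proof. by apply/smoothP => k; exact: Ck_coord. Qed.

Lemma smoothZ c (f : 'rV[R]_n -> R) : smooth f -> smooth (fun x => c * f x).
Proof. by move=> /smoothP sf; apply/smoothP => k; apply: CkZ => //; exact: openT. Qed.

Lemma derive_pw e p i x : 0 < e ->
  'D_(delta_mx 0 i) (pw e p) x = 2 * p * x 0 i * pw e (p - 1) x.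
Proof.
move=> e0; have d1 : is_derive x (delta_mx 0 i) (sqn \+ cst e) (2 * x 0 i).
  have := is_deriveD (is_derive_sqn x i) (is_derive_cst e x (delta_mx 0 i)).
  by rewrite addr0.
have d2 := is_derive1_powR p (sqnD_gt0 x e0).
have [_ H] := @is_derive_comp1 _ _ (fun t : R => t `^ p) (sqn \+ cst e) x (delta_mx 0 i)
  (@ex_derive _ _ _ _ _ _ _ d1) (@ex_derive _ _ _ _ _ _ _ d2).
rewrite [LHS]H (@derive_val _ _ _ _ _ _ _ d1) (@derive_val _ _ _ _ _ _ _ d2) /pw; ring.
Qed.

End pw.

(** * Integration by parts against a function of H^1_0 *)

Section parts.
Context {R : realType} {n : nat}.
Local Notation mu := (@lebesgue_rV R n).
Variables (W : set 'rV[R]_n) (a b : 'rV[R]_n).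
Hypotheses (oW : open W) (Wab : W `<=` cbox a b).
Implicit Types (u v : 'rV[R]_n -> R) (i : 'I_n).

Let mW : measurable W := open_measurable_rV oW.

Lemma mu_boundedW : (mu W < +oo)%E.
Proof.
apply: le_lt_trans (lebesgue_cbox_fin a b); apply: le_measure; rewrite ?inE//.
exact: measurable_cbox.
Qed.

Lemma smooth_boundedW f : smooth f -> exists M, forall x, W x -> `|f x| <= M.
Proof.
move=> sf; have [M HM] := continuous_bounded_compact (smooth_continuous sf) (@compact_cbox _ _ a b).
by exists M => x /Wab/HM.
Qed.

Lemma sqint_smooth f v : smooth f -> sqint mu W v -> sqint mu W (fun x => f x * v x).
Proof.
move=> sf lv; have [M HM] := smooth_boundedW sf.
apply: (sqint_mulbd mW _ HM) => //; apply: continuous_measurable_rV => //.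
exact: smooth_continuous.
Qed.

Lemma sqint_test phi : test_function W phi -> sqint mu W phi.
Proof.
move=> tp; have [M HM] := test_bounded tp; have [sp _ _] := tp.
apply: (sqint_bounded mW mu_boundedW (M := M)) => //.
by apply: continuous_measurable_rV => //; exact: smooth_continuous.
Qed.

(* [phi] tends to [u] in H^1, [v] being the weak gradient of [u]. *)
Definition h10_approx u (v : 'I_n -> 'rV[R]_n -> R) (phi : nat -> 'rV[R]_n -> R) :=
  [/\ forall j, test_function W (phi j),
   ((fun j => \int[mu]_(x in W) ((phi j x - u x) ^+ 2)%:E) @ \oo --> 0)%E &
   forall i, ((fun j => \int[mu]_(x in W) (('D_(delta_mx 0 i) (phi j) x - v i x) ^+ 2)%:E) @ \oo --> 0)%E].

Definition weak_d i v dv := forall phi, test_function W phi ->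
  \int[mu]_(x in W) (v x * 'D_(delta_mx 0 i) phi x) = - \int[mu]_(x in W) (dv x * phi x).

(** For each approximant, [phi j] times [f] is a test function and can be put into the weak identity
    for [v]; then [j] tends to infinity. All boundary information sits in [u], so [v] may be a
    derivative of [u], about whose boundary values nothing is known. *)
Lemma weak_parts u (ud : 'I_n -> 'rV[R]_n -> R) phi i v dv f :
  h10_approx u ud phi -> sqint mu W u -> (forall i, sqint mu W (ud i)) ->
  sqint mu W v -> sqint mu W dv -> weak_d i v dv -> smooth f ->
  \int[mu]_(x in W) (ud i x * (f x * v x)) +
  \int[mu]_(x in W) (u x * ('D_(delta_mx 0 i) f x * v x)) =
  - \int[mu]_(x in W) (u x * (f x * dv x)).
Proof.
move=> [tp cp cdp] lu lud lv ldv wd sf.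
have lp j : sqint mu W (phi j) := sqint_test (tp j).
have ldp j : sqint mu W ('D_(delta_mx 0 i) (phi j)) := sqint_test (test_partial i (tp j)).
have lfv := sqint_smooth sf lv; have lfdv := sqint_smooth sf ldv.
have ldfv := sqint_smooth (smooth_partial i sf) lv.
have c1 := cvg_Rintegral_mul mW ldp (lud i) lfv (cdp i).
have c2 := cvg_Rintegral_mul mW lp lu ldfv cp.
have c3 := cvg_Rintegral_mul mW lp lu lfdv cp.
have E j : \int[mu]_(x in W) ('D_(delta_mx 0 i) (phi j) x * (f x * v x)) +
  \int[mu]_(x in W) (phi j x * ('D_(delta_mx 0 i) f x * v x)) =
  - \int[mu]_(x in W) (phi j x * (f x * dv x)).
  rewrite -RintegralD//; try exact: sqint_mul.
  have := wd _ (test_mul sf (tp j)).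
  rewrite (eq_Rintegral _ (f := fun x => dv x * (phi j \* f) x)
    (g := fun x => phi j x * (f x * dv x))); last by move=> x _ /=; ring.
  move=> <-; apply: eq_Rintegral => x _; rewrite derive_mul//; last by case: (tp j).
  ring.
pose F j := \int[mu]_(x in W) ('D_(delta_mx 0 i) (phi j) x * (f x * v x)) +
  \int[mu]_(x in W) (phi j x * ('D_(delta_mx 0 i) f x * v x)).
have H1 : F @ \oo -->
  \int[mu]_(x in W) (ud i x * (f x * v x)) +
  \int[mu]_(x in W) (u x * ('D_(delta_mx 0 i) f x * v x)) by exact: cvgD c1 c2.
apply: cvg_unique H1 _ => //.
have -> : F = (fun j => - \int[mu]_(x in W) (phi j x * (f x * dv x))).
  by apply/funext => j; exact: E.
exact: cvgN c3.
Qed.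

End parts.

Lemma Rintegral_sum d (T : measurableType d) (R : realType)
    (mu : {measure set T -> \bar R}) (D : set T) (I : Type) (s : seq I)
    (F : I -> T -> R) : measurable D ->
  (forall i, mu.-integrable D (EFin \o F i)) ->
  mu.-integrable D (EFin \o (fun x => \sum_(i <- s) F i x)) /\
  \int[mu]_(x in D) (\sum_(i <- s) F i x) = \sum_(i <- s) \int[mu]_(x in D) F i x.
Proof.
move=> mD iF; elim: s => [|i s [IH1 IH2]].
  have E : (fun x => \sum_(j <- [::]) F j x) = cst 0 by apply/funext => x; rewrite big_nil.
  rewrite E big_nil; split; first exact: integrable0.
  by rewrite Rintegral_cst// mul0r.
have E : (fun x => \sum_(j <- i :: s) F j x) = (fun x => F i x + \sum_(j <- s) F j x).
  by apply/funext => x; rewrite big_cons.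
rewrite E big_cons -IH2; split; first exact: (integrableD mD (iF i) IH1).
by rewrite RintegralD.
Qed.

(** * The Rellich inequality with regularized weights *)

Section rellich_reg.
Context {R : realType} {n : nat}.
Local Notation mu := (@lebesgue_rV R n).
Variables (W : set 'rV[R]_n) (a b : 'rV[R]_n).
Hypotheses (oW : open W) (Wab : W `<=` cbox a b).
Variables (u : 'rV[R]_n -> R) (ud udd : 'I_n -> 'rV[R]_n -> R) (phi : nat -> 'rV[R]_n -> R).
Hypotheses (ha : h10_approx W u ud phi) (lu : sqint mu W u)
  (lud : forall i, sqint mu W (ud i)) (ludd : forall i, sqint mu W (udd i))
  (wu : forall i, weak_d W i u (ud i)) (wud : forall i, weak_d W i (ud i) (udd i)).
Variables (m e : R).
Hypotheses (e0 : 0 < e).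

Let mW : measurable W := open_measurable_rV oW.
Let p : R := - (m + 1).
Let N : R := n%:R.
Let q : R := (N - 4 - 2 * m) / 4.
Let gam : R := (N - 4 - 2 * m) * (N + 2 * m) / 4.
Let P (x : 'rV[R]_n) : R := pw e (p - 2) x.
Let rho x : R := @sqn R n x + e.

Let pw1 x : pw e (p - 1) x = P x * rho x.
Proof. by rewrite /P /rho -pwS//; congr (pw _ _ _); ring. Qed.

Let pw0 x : pw e p x = P x * rho x ^+ 2.
Proof. by rewrite expr2 mulrA -pw1 -pwS//; congr (pw _ _ _); ring. Qed.

(** With [G] as below this is (N - 2)/2 D_i G_i - 4 q^2 x_i^2 rho^(p-2): the potential left over
    once the square in direction [i] is completed. Summed over [i] it gives gam rho^(p-1) plus a
    nonnegative term with a factor [e]. *)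
Let S i x : R := (N - 2) / 2 * pw e (p - 1) x +
  ((N - 2) * (p - 1) - 4 * q ^+ 2) * x 0 i ^+ 2 * P x.

Let G i := (fun x : 'rV[R]_n => x 0 i) \* pw e (p - 1).

Let smooth_G i : smooth (G i).
Proof. by apply: smoothM; [exact: smooth_coord|exact: smooth_pw]. Qed.

Let derive_G i x : 'D_(delta_mx 0 i) (G i) x =
  pw e (p - 1) x + 2 * (p - 1) * x 0 i ^+ 2 * P x.
Proof.
rewrite derive_mul; [|exact: smooth_coord|exact: smooth_pw].
have [_ ->] := is_derive_coord x (delta_mx 0 i) i.
rewrite mxE !eqxx/= derive_pw// mul1r; congr (_ + _).
by rewrite (_ : p - 1 - 1 = p - 2) /P; ring.
Qed.

Let sqs f v w : smooth f -> sqint mu W v -> sqint mu W w ->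
  mu.-integrable W (EFin \o (fun x => w x * (f x * v x))).
Proof. by move=> sf lv lw; apply: (sqint_mul mW) => //; exact: (sqint_smooth oW Wab). Qed.

Let smooth_S i : smooth (S i).
Proof.
apply: smoothD; first by apply: smoothZ; exact: smooth_pw.
apply: smoothM; last exact: smooth_pw.
apply: smoothZ; rewrite (_ : (fun x : 'rV[R]_n => _) =
  (fun x : 'rV[R]_n => x 0 i) \* (fun x : 'rV[R]_n => x 0 i)).
  by apply: smoothM; exact: smooth_coord.
by apply/funext => x; rewrite expr2.
Qed.

(* The difference of the two sides is the integral of a square times a weight,
   namely rho^p |d_i u + 2 q (x_i / rho) u|^2 : this is the weighted Hardy
   inequality with ground state rho^(-q). *)
Let int_S_le i : \int[mu]_(x in W) (u x * (S i x * u x)) <=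
  - \int[mu]_(x in W) (u x * (pw e p x * udd i x)).
Proof.
have sp := smooth_pw (n := n) p e0.
have := weak_parts oW Wab ha lu lud (lud i) (ludd i) (wud i) sp => <-.
have := weak_parts oW Wab ha lu lud lu (lud i) (wu i) (smooth_G i) => H.
have {}H : \int[mu]_(x in W) (u x * ('D_(delta_mx 0 i) (G i) x * u x)) =
   (- 2) * \int[mu]_(x in W) (u x * (G i x * ud i x)).
  move: H; rewrite (eq_Rintegral _ (f := fun x => ud i x * (G i x * u x))
    (g := fun x => u x * (G i x * ud i x))); last by move=> x _ /=; ring.
  by move=> H; lra.
have i1 : mu.-integrable W (EFin \o (fun x => u x * (S i x * u x))) by exact: sqs.
have i2 : mu.-integrable W (EFin \o (fun x => u x * ('D_(delta_mx 0 i) (G i) x * u x))).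
  by apply: sqs => //; exact: smooth_partial.
have i3 : mu.-integrable W (EFin \o (fun x => u x * (G i x * ud i x))) by exact: sqs.
have i4 : mu.-integrable W (EFin \o (fun x => ud i x * (pw e p x * ud i x))) by exact: sqs.
have i5 : mu.-integrable W (EFin \o (fun x => u x * ('D_(delta_mx 0 i) (pw e p) x * ud i x))).
  by apply: sqs => //; exact: smooth_partial.
have i2' := integrableZl mW ((N - 2) / 2) i2.
have i3' := integrableZl mW (N - 2) i3.
rewrite -subr_ge0.
(* Adds (N - 2)/2 times the vanishing integral of the weak derivative of G_i u^2. Since 2p + N - 2 =
   4q, the cross term becomes that of the desired square. *)
have -> : \int[mu]_(x in W) (ud i x * (pw e p x * ud i x)) +
  \int[mu]_(x in W) (u x * ('D_(delta_mx 0 i) (pw e p) x * ud i x)) -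
  \int[mu]_(x in W) (u x * (S i x * u x)) =
  \int[mu]_(x in W) (ud i x * (pw e p x * ud i x) +
   u x * ('D_(delta_mx 0 i) (pw e p) x * ud i x) +
   ((N - 2) / 2 * (u x * ('D_(delta_mx 0 i) (G i) x * u x)) +
    (N - 2) * (u x * (G i x * ud i x)) -
    u x * (S i x * u x))).
  rewrite RintegralD//; first last.
  - exact: (integrableB mW (integrableD mW i2' i3') i1).
  - exact: (integrableD mW i4 i5).
  rewrite RintegralD// RintegralB//; last exact: (integrableD mW i2' i3').
  by rewrite RintegralD// !RintegralZl// H; field.
apply: Rintegral_ge0 => x Wx.
rewrite (_ : _ + _ = P x * (ud i x * rho x + 2 * q * u x * x 0 i) ^+ 2).
  by rewrite mulr_ge0 ?sqr_ge0// ltW// pw_gt0.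
by rewrite derive_G derive_pw// /S /G /= !pw1 pw0 /q /p; field.
Qed.

Hypotheses (n2 : 2 <= N) (gam0 : 0 <= gam).

Let sumS x : gam * pw e (p - 1) x <= \sum_i S i x.
Proof.
rewrite big_split/= sumr_const card_ord -mulr_suml -mulr_sumr -/(sqn x).
rewrite -mulr_natl -/N pw1.
have P0 : 0 < P x by exact: pw_gt0.
(* At e = 0 there is equality. Writing |x|^2 = rho - e leaves this slack, nonnegative because N >=
   2. *)
rewrite -subr_ge0 (_ : _ - _ = P x * (e * (N * (N - 2) / 2 - gam))).
  rewrite mulr_ge0 ?(ltW P0)// mulr_ge0 ?(ltW e0)//.
  rewrite (_ : _ - gam = (N - 2) * (N + 2) / 4 + (m + 1) ^+ 2); last by rewrite /gam; field.
  by rewrite addr_ge0 ?sqr_ge0// divr_ge0// mulr_ge0 ?subr_ge0// addr_ge0// ler0n.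
by rewrite /rho /gam /q /p; field.
Qed.

Lemma rellich_reg_linear :
  gam * \int[mu]_(x in W) (u x * (pw e (p - 1) x * u x)) <=
  - \int[mu]_(x in W) (u x * (pw e p x * \sum_i udd i x)).
Proof.
have iS i : mu.-integrable W (EFin \o (fun x => u x * (S i x * u x))) by exact: sqs.
have iD i : mu.-integrable W (EFin \o (fun x => u x * (pw e p x * udd i x))).
  by apply: sqs => //; exact: smooth_pw.
have [IS ES] := Rintegral_sum (index_enum 'I_n) mW iS.
have [ID ED] := Rintegral_sum (index_enum 'I_n) mW iD.
have ip : mu.-integrable W (EFin \o (fun x => u x * (pw e (p - 1) x * u x))).
  by apply: sqs => //; exact: smooth_pw.
apply: (@le_trans _ _ (\int[mu]_(x in W) (\sum_i (u x * (S i x * u x))))).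
  rewrite -RintegralZl//; apply: le_Rintegral => //.
    exact: (integrableZl mW gam ip).
  move=> x _; rewrite -mulr_sumr -mulr_suml.
  rewrite (_ : gam * _ = u x ^+ 2 * (gam * pw e (p - 1) x)); last by ring.
  rewrite (_ : u x * _ = u x ^+ 2 * \sum_i S i x); last by ring.
  by rewrite ler_wpM2l ?sqr_ge0.
rewrite ES; apply: (@le_trans _ _ (\sum_i - \int[mu]_(x in W) (u x * (pw e p x * udd i x)))).
  by apply: ler_sum => i _; exact: int_S_le.
rewrite sumrN -ED lerN2 le_eqVlt; apply/orP; left; apply/eqP.
by apply: eq_Rintegral => x _; rewrite -!mulr_sumr.
Qed.

(* Expand 0 <= rho^(p-1) (rho Lap u + gam u)^2. *)
Lemma rellich_reg : gam ^+ 2 * \int[mu]_(x in W) (pw e (p - 1) x * u x ^+ 2) <=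
  \int[mu]_(x in W) (pw e (p + 1) x * (\sum_i udd i x) ^+ 2).
Proof.
have ls : sqint mu W (fun x => \sum_i udd i x).
  by apply: sqint_sum => //; exact: mu_boundedW oW Wab.
have sp t := smooth_pw (n := n) t e0.
have i1 : mu.-integrable W (EFin \o (fun x => u x * (pw e (p - 1) x * u x))) by exact: sqs.
have i2 : mu.-integrable W (EFin \o (fun x => u x * (pw e p x * \sum_i udd i x))) by exact: sqs.
have i3 : mu.-integrable W (EFin \o (fun x => (\sum_i udd i x) * (pw e (p + 1) x * \sum_i udd i x))) by exact: sqs.
rewrite (eq_Rintegral _ (f := fun x => pw e (p - 1) x * u x ^+ 2)
    (g := fun x => u x * (pw e (p - 1) x * u x))); last by move=> x _ /=; ring.
rewrite (eq_Rintegral _ (f := fun x => pw e (p + 1) x * (\sum_i udd i x) ^+ 2)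
    (g := fun x => (\sum_i udd i x) * (pw e (p + 1) x * \sum_i udd i x))); last by move=> x _ /=; ring.
have H := rellich_reg_linear.
have : 0 <= \int[mu]_(x in W) ((\sum_i udd i x) * (pw e (p + 1) x * \sum_i udd i x) +
   (2 * gam * (u x * (pw e p x * \sum_i udd i x)) +
    gam ^+ 2 * (u x * (pw e (p - 1) x * u x)))).
  apply: Rintegral_ge0 => x Wx.
  rewrite (_ : _ + _ = pw e (p - 1) x * (rho x * (\sum_i udd i x) + gam * u x) ^+ 2).
    by rewrite mulr_ge0 ?sqr_ge0// ltW// pw_gt0.
  rewrite pwS// pw0 pw1 -/(rho x); ring.
have i2' := integrableZl mW (2 * gam) i2.
have i1' := integrableZl mW (gam ^+ 2) i1.
rewrite RintegralD//; last exact: (integrableD mW i2' i1').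
rewrite RintegralD// !RintegralZl//.
set X := \int[mu]_(x in W) _; set Y := \int[mu]_(x in W) _ in H *; set Z := \int[mu]_(x in W) _ in H *.
(* Here gam >= 0 is used: twice the linear inequality times gam, minus the term gam^2 Y of the
   expanded square, leaves one gam^2 Y. *)
have : gam * (gam * Y) <= gam * (- Z) by rewrite ler_wpM2l.
nra.
Qed.

End rellich_reg.

Section limn_einf.
Local Open Scope ereal_scope.

Lemma limn_einf_le_lim (R : realType) (u v : (\bar R)^nat) l :
  (forall k, u k <= v k) -> v @ \oo --> l -> limn_einf u <= l.
Proof.
move=> uv vl; rewrite limn_einf_lim -(cvg_lim (@ereal_hausdorff R) vl).
apply: lee_lim; [exact: is_cvg_einfs|exact: cvgP vl|].
apply: nearW => k; apply: le_trans (uv k).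
by apply: ereal_inf_lbound; exists k => //=.
Qed.

End limn_einf.

Section ball.
Context {R : realType} {n : nat}.
Implicit Types x : 'rV[R]_n.
Local Notation mu := (@lebesgue_rV R n).

Lemma enorm_powR x t : enorm x `^ (2 * t) = sqn x `^ t.
Proof.
rewrite /enorm -/(sqn x) -powR12_sqrt ?sqn_ge0// -powRrM.
by congr (_ `^ _); rewrite mulrA mulVf ?mul1r.
Qed.

Lemma eball_sqn (r : R) : 0 < r -> eball r = [set x : 'rV[R]_n | sqn x < r ^+ 2].
Proof.
move=> r0; apply/seteqP; split => x; rewrite /eball/= /enorm -/(sqn x) => h.
  by rewrite -(sqr_sqrtr (sqn_ge0 x)) ltr_pXn2r ?nnegrE ?sqrtr_ge0 ?ltW.
by rewrite -(@ltr_pXn2r _ 2) ?nnegrE ?sqrtr_ge0 ?(ltW r0)// sqr_sqrtr ?sqn_ge0.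
Qed.

Lemma continuous_sqn : continuous (@sqn R n).
Proof. by move=> x; apply: (Ck_cont (k := 0) (Ck_sqn 0 openT)). Qed.

Lemma open_eball (r : R) : 0 < r -> open (@eball R n r).
Proof.
move=> r0; rewrite eball_sqn//.
apply: (@open_comp _ _ (@sqn R n) [set t | t < r ^+ 2]); last exact: open_lt.
by move=> x _; exact: continuous_sqn.
Qed.

Lemma sqn_ge_coord x i : x 0 i ^+ 2 <= sqn x.
Proof. by rewrite /sqn (bigD1 i)//= lerDl sumr_ge0// => j _; rewrite sqr_ge0. Qed.

Lemma eball_cbox (r : R) : 0 < r -> @eball R n r `<=` cbox (const_mx (- r)) (const_mx r).
Proof.
move=> r0; rewrite eball_sqn// => x /= xr i; rewrite in_itv/= !mxE -ler_norml.
rewrite -(@ler_pXn2r _ 2) ?nnegrE ?(ltW r0)//.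
by rewrite real_normK ?num_real//; apply: le_trans (sqn_ge_coord x i) (ltW xr).
Qed.

Lemma measurable_sqn_powR (D : set 'rV[R]_n) t : measurable D ->
  measurable_fun D (fun x => sqn x `^ t).
Proof.
move=> mD; apply: (@measurableT_comp _ _ _ _ _ _ (fun y : R => y `^ t)).
  exact: measurable_powR.
by apply: continuous_measurable_rV => //; exact: continuous_sqn.
Qed.

(** The origin is a box with a side of length 0. Off this null set the powers of |x|^2 are positive
    and continuous, so default values of [powR] at 0 do not matter. *)
Lemma ae_sqn_neq0 : (0 < n)%N -> {ae mu, forall x, sqn x != 0}.
Proof.
move=> n0; exists (cbox 0 0); split; first exact: measurable_cbox.
  rewrite lebesgue_rV_box; last by move=> i; rewrite !mxE.
  by case: n n0 => // k _; rewrite big_ord_recl !mxE subrr mul0r.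
move=> x /= /negP; rewrite negbK => /eqP x0 i; rewrite in_itv/= !mxE.
have := sqn_ge_coord x i; rewrite x0 => h.
have /eqP : x 0 i ^+ 2 = 0 by apply/eqP; rewrite eq_le h sqr_ge0.
by rewrite sqrf_eq0 => /eqP ->; rewrite lexx.
Qed.

Lemma rellich_numE m W (u : 'rV[R]_n -> R) : rellich_num m W u =
  (\int[mu]_(x in W) (sqn x `^ (- m) * wlaplacian W u x ^+ 2)%:E)%E.
Proof.
apply: eq_integral => x _; rewrite enorm_powR powRN real_normK ?num_real//.
by rewrite mulrC.
Qed.

Lemma rellich_denE m W (u : 'rV[R]_n -> R) : rellich_den m W u =
  (\int[mu]_(x in W) (sqn x `^ (- (m + 2)) * u x ^+ 2)%:E)%E.
Proof.
apply: eq_integral => x _; rewrite (_ : 2 * m + 4 = 2 * (m + 2)); last by ring.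
by rewrite enorm_powR powRN mulrC.
Qed.

Lemma cvg_pw t x : sqn x != 0 ->
  pw (k.+1%:R^-1 : R) t x @[k --> \oo] --> sqn x `^ t.
Proof.
move=> x0; have x1 : 0 < sqn x by rewrite lt_neqAle eq_sym x0 sqn_ge0.
have c : {for sqn x, continuous (fun y : R => y `^ t)}.
  exact: (is_derive_continuous (is_derive1_powR t x1)).
have : (fun k => sqn x + k.+1%:R^-1) @ \oo --> sqn x + 0.
  by apply: cvgD; [exact: cvg_cst|exact: cvg_harmonic].
by rewrite addr0 => H; exact: (cvg_comp _ _ H c).
Qed.

End ball.

(** * Removing the regularization *)

Section lower.
Context {R : realType} {n : nat}.
Local Notation mu := (@lebesgue_rV R n).
Variables (W : set 'rV[R]_n) (r : R).
Hypotheses (oW : open W) (Wr : forall x, W x -> sqn x <= r).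
Variables (u w : 'rV[R]_n -> R) (m gam : R).
Hypotheses (mu_ : measurable_fun W u) (lw : sqint mu W w) (n0 : (0 < n)%N)
  (num_fin : (\int[mu]_(x in W) (sqn x `^ (- m) * w x ^+ 2)%:E < +oo)%E).
Hypothesis reg : forall e, 0 < e ->
  (\int[mu]_(x in W) (gam ^+ 2 * (pw e (- (m + 2)) x * u x ^+ 2))%:E <=
   \int[mu]_(x in W) (pw e (- m) x * w x ^+ 2)%:E)%E.

Let mW : measurable W := open_measurable_rV oW.

Let mpw (e t : R) : 0 < e -> measurable_fun W (pw e t).
Proof.
by move=> e0; apply: continuous_measurable_rV => //; apply: smooth_continuous; exact: smooth_pw.
Qed.

Let e_ (k : nat) : R := k.+1%:R^-1.
Let e_gt0 k : 0 < e_ k. Proof. by rewrite invr_gt0. Qed.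
Let e_le1 k : e_ k <= 1. Proof. by rewrite invf_le1// ler1n. Qed.

Lemma cvg_reg_num :
  ((fun k => \int[mu]_(x in W) (pw (e_ k) (- m) x * w x ^+ 2)%:E) @ \oo -->
   \int[mu]_(x in W) (sqn x `^ (- m) * w x ^+ 2)%:E)%E.
Proof.
have mw2 : measurable_fun W (fun x => w x ^+ 2) by apply: measurable_funX; case: lw.
pose C := (r + 1) `^ (- m).
have ig1 : mu.-integrable W (EFin \o (fun x => sqn x `^ (- m) * w x ^+ 2)).
  apply/integrableP; split.
    apply/measurable_EFinP; apply: measurable_funM => //; exact: measurable_sqn_powR.
  rewrite (eq_integral (fun x => (sqn x `^ (- m) * w x ^+ 2)%:E))// => x _ /=.
  by rewrite ger0_norm// mulr_ge0 ?sqr_ge0// powR_ge0.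
have ig2 := integrableZl mW C (sqint_integrable lw).
have [|||||_ _ //] := @dominated_convergence _ _ _ mu W mW
   (fun k x => (pw (e_ k) (- m) x * w x ^+ 2)%:E)
   (fun x => (sqn x `^ (- m) * w x ^+ 2)%:E)
   (fun x => (sqn x `^ (- m) * w x ^+ 2 + C * w x ^+ 2)%:E).
- by move=> k; apply/measurable_EFinP; apply: measurable_funM => //; exact: mpw.
- by apply/measurable_EFinP; apply: measurable_funM => //; exact: measurable_sqn_powR.
- apply: filterS (ae_sqn_neq0 (R := R) n0) => x x0 _.
  by apply: cvg_EFin; [exact: nearW|by apply: cvgM; [exact: cvg_pw|exact: cvg_cst]].
- exact: (integrableD mW ig1 ig2).
- apply: filterS (ae_sqn_neq0 (R := R) n0) => x x0 k Wx.
  have x1 : 0 < sqn x by rewrite lt_neqAle eq_sym x0 sqn_ge0.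
  rewrite lee_fin -mulrDl normrM [X in _ * X]ger0_norm ?sqr_ge0//.
  rewrite ler_wpM2r ?sqr_ge0// ger0_norm ?powR_ge0//.
  (* For m >= 0 the regularized weight is at most |x|^(-2m), and the numerator is finite. For m < 0
     it is at most the constant [C], as |x|^2 <= r and the parameter is at most 1, and [w] is square
     integrable. The sum of both majorants covers the two cases. *)
  have [m0|m0] := leP 0 m.
    apply: (@le_trans _ _ (sqn x `^ (- m))); last by rewrite lerDl powR_ge0.
    rewrite /pw !powRN lef_pV2 ?posrE ?powR_gt0 ?sqnD_gt0//.
    by rewrite ge0_ler_powR ?nnegrE ?sqn_ge0 ?(ltW (sqnD_gt0 _ (e_gt0 k)))// lerDl ltW.
  apply: (@le_trans _ _ C); last by rewrite lerDr powR_ge0.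
  rewrite /pw ge0_ler_powR ?nnegrE ?oppr_ge0 ?(ltW m0) ?(ltW (sqnD_gt0 _ (e_gt0 k)))//; last first.
    by rewrite lerD// Wr.
  by rewrite addr_ge0// (le_trans _ (Wr Wx))// ltW.
Qed.

Lemma reg_limit :
  ((gam ^+ 2)%:E * \int[mu]_(x in W) (sqn x `^ (- (m + 2)) * u x ^+ 2)%:E <=
   \int[mu]_(x in W) (sqn x `^ (- m) * w x ^+ 2)%:E)%E.
Proof.
have mu2 : measurable_fun W (fun x => u x ^+ 2) by exact: measurable_funX.
have mf k : measurable_fun W (fun x => (gam ^+ 2 * (pw (e_ k) (- (m + 2)) x * u x ^+ 2))%:E).
  apply/measurable_EFinP; apply: measurable_funM => //; apply: measurable_funM => //.
  exact: mpw.
have mg : measurable_fun W (fun x => (sqn x `^ (- (m + 2)) * u x ^+ 2)%:E).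
  by apply/measurable_EFinP; apply: measurable_funM => //; exact: measurable_sqn_powR.
have f0 k x : W x -> (0 <= (gam ^+ 2 * (pw (e_ k) (- (m + 2)) x * u x ^+ 2))%:E)%E.
  by move=> _; rewrite lee_fin mulr_ge0 ?sqr_ge0// mulr_ge0 ?sqr_ge0// powR_ge0.
rewrite -ge0_integralZl_EFin ?sqr_ge0//; last first.
  by move=> x _; rewrite lee_fin mulr_ge0 ?sqr_ge0// powR_ge0.
apply: le_trans (limn_einf_le_lim (fun k => reg (e_gt0 k)) cvg_reg_num).
apply: le_trans (fatou mu mW mf f0).
rewrite le_eqVlt; apply/orP; left; apply/eqP.
apply: ae_eq_integral => //.
- exact: measurable_funeM.
- apply: (@measurableT_comp _ _ _ _ _ _ (fun y : \bar R => - y)%E); first exact: oppe_measurable.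
  apply: (@measurable_fun_limn_esup _ _ _ W (fun k x => - (gam ^+ 2 * (pw (e_ k) (- (m + 2)) x * u x ^+ 2))%:E)%E).
  by move=> k; exact: measurableT_comp (mf k).
- apply: filterS (ae_sqn_neq0 (R := R) n0) => x x0 Wx.
  have c : ((fun k => (gam ^+ 2 * (pw (e_ k) (- (m + 2)) x * u x ^+ 2))%:E) @ \oo -->
    (gam ^+ 2 * (sqn x `^ (- (m + 2)) * u x ^+ 2))%:E)%E.
    apply: cvg_EFin; first exact: nearW.
    apply: cvgM; first exact: cvg_cst.
    by apply: cvgM; [exact: cvg_pw|exact: cvg_cst].
  by rewrite is_cvg_limn_einfE; [rewrite (cvg_lim _ c)|exact: cvgP c].
Qed.

End lower.

Section rellich_lower.
Context {R : realType} {n : nat}.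
Local Notation mu := (@lebesgue_rV R n).
Implicit Types (u v : 'rV[R]_n -> R).

Lemma sobolev_wpartials k (W : set 'rV[R]_n) u s : open W -> sobolev k W u -> (size s <= k)%N ->
  weak_partials W s u (wpartials W s u) /\ sqint mu W (wpartials W s u).
Proof.
move=> oW [_ H] /H[v wv lv].
have [wp ae] := wpartialsP oW wv; split => //.
have [_ [mv _] _] := wp.
exact: (sqint_ae (open_measurable_rV oW) mv ae lv).
Qed.

(** Even the weak derivative of order 0 is a chosen representative, equal to [u] only almost
    everywhere; the convergence required by [sobolev0] is stated with it. *)
Lemma wpartials_nil (W : set 'rV[R]_n) u v : open W -> weak_partials W [::] u v ->
  {ae mu, forall x, W x -> wpartials W [::] u x = u x}.
Proof.
move=> oW wv; have [lu _ _] := wv.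
have wu : weak_partials W [::] u u by split => // phi tp; rewrite expr0 mul1r.
exact: (wpartialsP oW wu).2.
Qed.

Lemma rellich_lower (m r : R) u : (0 < n)%N -> - (n%:R / 2) <= m -> m <= (n%:R - 4) / 2 ->
  0 < r -> (sobolev 2 (eball r) `&` sobolev0 1 (eball r)) u ->
  (rellich_num m (eball r) u < +oo)%E ->
  ((((n%:R - 4 - 2 * m) * (n%:R + 2 * m) / 4) ^+ 2)%:E * rellich_den m (eball r) u <=
   rellich_num m (eball r) u)%E.
Proof.
move=> n0 m1 m2 r0 [s2 [s1 [phi [tphi cphi]]]] numoo.
set W := eball r in s2 s1 phi tphi cphi numoo *.
have oW : open W := open_eball r0; have mW := open_measurable_rV oW.
set gam := _ / 4.
pose ud i := wpartials W [:: i] u; pose udd i := wpartials W [:: i; i] u.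
have [w0 l0] := sobolev_wpartials (s := [::]) oW s2 isT.
have w1 i := (sobolev_wpartials (s := [:: i]) oW s2 isT).1.
have lud i : sqint mu W (ud i) := (sobolev_wpartials (s := [:: i]) oW s2 isT).2.
have w2 i := (sobolev_wpartials (s := [:: i; i]) oW s2 isT).1.
have ludd i : sqint mu W (udd i) := (sobolev_wpartials (s := [:: i; i]) oW s2 isT).2.
have lu : sqint mu W u by case: s2.
have aeu := wpartials_nil oW w0.
have wu i : weak_d W i u (ud i).
  by move=> psi tp; have [_ _ /(_ psi tp)] := w1 i; rewrite /= expr1 mulN1r.
(* The identity for [ud i], applied to the test function D_i psi, is compared with the second order
   identity for [:: i; i]; the two signs cancel. *)
have wud i : weak_d W i (ud i) (udd i).
  move=> psi tp; have [_ _ /(_ psi tp)] := w2 i; rewrite /= expr2 mulrNN mulr1 mul1r => E2.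
  have := wu i _ (test_partial i tp); rewrite E2 => ->; by rewrite opprK.
have ha : h10_approx W u ud phi.
  split => //; last by move=> i; exact: (cphi [:: i]).
  have := cphi [::] isT; rewrite /=.
  have -> // : (fun j => \int[mu]_(x in W) ((phi j x - wpartials W [::] u x) ^+ 2)%:E)%E =
    (fun j => \int[mu]_(x in W) ((phi j x - u x) ^+ 2)%:E)%E.
  apply/funext => j; have mp : measurable_fun W (phi j).
    by apply: continuous_measurable_rV => //; case: (tphi j) => /smooth_continuous.
  apply: ae_eq_integral => //.
  - by apply/measurable_EFinP; apply: measurable_funX; apply: measurable_funB => //; case: l0.
  - by apply/measurable_EFinP; apply: measurable_funX; apply: measurable_funB => //; case: lu.
  - by apply: filterS aeu => x h /h ->.
have Wab := eball_cbox (n := n) r0.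
have N2 : (2 : R) <= n%:R by lra.
have gam0 : 0 <= gam by rewrite /gam divr_ge0// mulr_ge0; lra.
rewrite rellich_denE; move: numoo; rewrite rellich_numE => numoo.
have lw : sqint mu W (wlaplacian W u).
  by apply: sqint_sum => //; exact: mu_boundedW oW (eball_cbox r0).
apply: (@reg_limit _ _ W (r ^+ 2)) => //.
- by move=> x; rewrite /W eball_sqn// => /ltW.
- by case: lu.
move=> e e0.
have := rellich_reg oW Wab ha lu lud ludd wu wud e0 N2 gam0.
have mp t : measurable_fun W (pw e t).
  by apply: continuous_measurable_rV => //; apply: smooth_continuous; exact: smooth_pw.
have I t f : sqint mu W f -> mu.-integrable W (EFin \o (fun x => pw e t x * f x ^+ 2)).
  move=> lf.
  have -> : (fun x => pw e t x * f x ^+ 2) = (fun x => f x * (pw e t x * f x)).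
    by apply/funext => x; ring.
  by apply: (sqint_mul mW) => //; exact: (sqint_smooth oW Wab (smooth_pw t e0)).
have E t f : sqint mu W f -> (\int[mu]_(x in W) (pw e t x * f x ^+ 2)%:E)%E =
   (\int[mu]_(x in W) (pw e t x * f x ^+ 2))%:E.
  by move=> lf; rewrite /Rintegral fineK//; apply: integrable_fin_num => //; exact: I.
rewrite (_ : - (m + 1) - 1 = - (m + 2)); last by ring.
rewrite (_ : - (m + 1) + 1 = - m); last by ring.
rewrite -/gam -lee_fin EFinM -!E//.
rewrite -integralZl//; last exact: I.
Qed.

End rellich_lower.

(** * A minimizing sequence *)

Section scale.
Context {R : realType}.
Local Notation leb := (@lebesgue_measure R).
Local Open Scope ereal_scope.

Let dbl : measurableTypeR R -> measurableTypeR R := fun t => (2 * t)%R.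

Let two : {nonneg R} := 2%:nng%R.

Let mdbl : measurable_fun setT dbl.
Proof. exact: measurable_funM. Qed.

Let pleb := measure_function_pushforward__canonical__measure_function_Measure leb mdbl.

Lemma lebesgue_measure_double (A : set (measurableTypeR R)) : measurable A ->
  leb A = (2%:R)%:E * leb (dbl @^-1` A).
Proof.
move=> mA; rewrite -[RHS]/(mscale two pleb A).
apply: lebesgue_measure_unique => // _ [[a b] ab <-].
rewrite /= /mscale /= /pushforward.
have -> : dbl @^-1` `]a, b]%classic = `](a / 2)%R, (b / 2)%R]%classic.
  apply/seteqP; split => x /=; rewrite !in_itv/= /dbl.
    by rewrite ltr_pdivrMr// ler_pdivlMr// mulrC.
  by rewrite ltr_pdivrMr// ler_pdivlMr// mulrC.
have h1 := @lebesgue_measure_itv R `]a, b]; have h2 := @lebesgue_measure_itv R `](a / 2)%R, (b / 2)%R].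
move: h1 h2 => /= -> ->; rewrite !lte_fin ltr_pM2r ?invr_gt0//.
case: ifPn => _; last by rewrite mule0.
by rewrite -!EFinB -EFinM; congr (_%:E); field.
Qed.

Lemma ge0_integral_double1 (f : measurableTypeR R -> \bar R) :
  measurable_fun setT f -> (forall t, 0 <= f t) ->
  \int[leb]_t f t = (2%:R)%:E * \int[leb]_t f (dbl t).
Proof.
move=> mf f0.
have := @ge0_integral_pushforward _ _ _ _ R dbl mdbl leb setT f measurableT mf (fun y _ => f0 y).
rewrite preimage_setT => <-.
rewrite -(@ge0_integral_mscale _ _ _ (pushforward leb dbl) setT measurableT two f)//.
by apply: eq_measure_integral => A mA _; exact: lebesgue_measure_double.
Qed.

(** Dilation by 2 commutes with splitting off the first coordinate, so each dimension contributes
    one factor 2. This single dilation suffices for dyadic shells. *)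
Lemma ge0_integral_double n (f : 'rV[R]_n -> \bar R) :
  measurable_fun setT f -> (forall x, 0 <= f x) ->
  \int[@lebesgue_rV R n]_x f x = ((2 : R) ^+ n)%R%:E * \int[@lebesgue_rV R n]_x f (2 *: x)%R.
Proof.
elim: n f => [|n IH] f mf f0.
  rewrite expr0 mul1e; apply: eq_integral => x _; congr f.
  by apply/rowP => -[].
have mdblr k : measurable_fun setT (fun x : 'rV[R]_k => (2 *: x)%R).
  apply: measurable_fun_rV => i; under eq_fun do rewrite mxE.
  by apply: measurable_funM => //; exact: measurable_coor.
have mf2 : measurable_fun setT (fun x : 'rV[R]_n.+1 => f (2 *: x)%R).
  exact: (measurableT_comp mf (mdblr n.+1)).
have mfc : measurable_fun setT (f \o cons_rV).
  by apply: measurableT_comp => //; exact: measurable_cons_rV.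
rewrite ge0_integral_cons// [in RHS]ge0_integral_cons//.
have E t y : (2 *: cons_rV (t, y) = cons_rV (2 * t, 2 *: y) :> 'rV[R]_n.+1)%R.
  apply/rowP => i; case: (unliftP ord0 i) => [j|] ->.
    by rewrite mxE !cons_rVS mxE.
  by rewrite mxE !cons_rV0.
have mF := @measurable_fun_fubini_tonelli_F _ _ _ _ R (@lebesgue_rV R n) (f \o cons_rV) mfc (fun x => f0 _).
rewrite ge0_integral_double1//; last by move=> t; apply: integral_ge0.
rewrite exprS EFinM -muleA; congr (_ * _).
have mF2 := @measurable_fun_fubini_tonelli_F _ _ _ _ R (@lebesgue_rV R n)
  ((fun x => f (2 *: x)%R) \o cons_rV) (measurableT_comp mf2 measurable_cons_rV) (fun x => f0 _).
rewrite -[RHS]ge0_integralZl_EFin//; first last.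
- by move=> t _; apply: integral_ge0.
apply: eq_integral => t _.
rewrite IH//; last first.
  exact: (measurableT_comp mfc (pair1_measurable _)).
by congr (_ * _); apply: eq_integral => y _; rewrite E.
Qed.

End scale.

Section oned.
Context {R : realType}.
Implicit Types (f g : R -> R) (s t x : R).

Lemma is_derive_mulR f g x df dg : is_derive x 1 f df -> is_derive x 1 g dg ->
  is_derive x 1 (fun t => f t * g t) (df * g x + f x * dg).
Proof.
move=> Df Dg; have [H1 H2] := is_deriveM Df Dg; split; first exact: H1.
by rewrite [LHS]H2 addrC; congr (_ + _); exact: mulrC.
Qed.

Lemma is_derive_scale_comp f x c df : is_derive (x * c) 1 f df ->
  is_derive x 1 (fun t => f (t * c)) (df * c).
Proof.
move=> [df1 df2].
have D : is_derive x 1 (fun t : R => t * c) c.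
  have := is_derive_mulR (@is_derive_id _ _ x 1) (is_derive_cst c x 1).
  by rewrite mulr0 addr0 mul1r.
have [d1 d2] := D.
by have := is_derive_comp1 d1 df1; rewrite df2 d2.
Qed.

(* The transition from 0 to 1 takes place in [2, 3], strictly inside the shell
   [1, 4], so that [radT] is constant outside of the open shell. *)
Definition theta t := sstep (1 * t + - 2).

Lemma Ck1_theta k U : open U -> Ck1 k U theta.
Proof.
move=> oU; apply: (@Ck1_comp _ _ _ setT sstep (fun t => 1 * t + - 2)) => //.
  by apply: Ck1_sstep; exact: openT.
exact: Ck1_affine.
Qed.

Lemma theta_le2 t : t <= 2 -> theta t = 0.
Proof. by move=> t2; rewrite /theta sstep_le0// mul1r subr_le0. Qed.

Lemma theta_ge3 t : 3 <= t -> theta t = 1.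
Proof. by move=> t3; rewrite /theta sstep_ge1// mul1r; lra. Qed.

Let th1 := 'D_1 theta.
Let th2 := 'D_1 th1.

Let Ck_th k : Ck1 k setT theta. Proof. by apply: Ck1_theta; exact: openT. Qed.

Let derive_th x : is_derive x 1 theta (th1 x).
Proof. by apply/derivableP; have [_ /(_ tt) [+ _]] := Ck_th 1; apply. Qed.

Let derive_th1 x : is_derive x 1 th1 (th2 x).
Proof. by apply/derivableP; have [_ /(_ tt) [_ [_ /(_ tt) [+ _]]]] := Ck_th 2; apply. Qed.

Lemma th12_cst c t x : nbhs x (fun y => theta y = c) -> th1 x = 0 /\ th2 x = 0.
Proof.
move=> nx; have n1 : \forall y \near x, th1 y = 0.
  have /nbhs_interior := nx; apply: filterS => y ny.
  by rewrite /th1 -(derive_cst c y 1); apply: near_eq_derive; exact: ny.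
split; first exact: nbhs_singleton n1.
by rewrite /th2 -(derive_cst (0 : R) x 1); apply: near_eq_derive.
Qed.

Variables (A B gam : R).

(* If chi(s) = theta(s / a), the Laplacian of |x|^(-2q) chi(|x|^2) is
   |x|^(-2q-2) radT(|x|^2 / a) for A = 4 and B = 2n - 8q. *)
Definition radT t := A * t ^+ 2 * th2 t + B * t * th1 t - gam * theta t.

Lemma radT_le1 t : t <= 1 -> radT t = 0.
Proof.
move=> t1; have [//|h1 h2] := @th12_cst 0 t t.
  near=> y; rewrite theta_le2//; apply: ltW; near: y; apply: lt_nbhsl.
  by rewrite (le_lt_trans t1)// ltr1n.
by rewrite /radT h1 h2 theta_le2 ?(le_trans t1)// ?ler1n// !mulr0 subr0 addr0.
Unshelve. all: by end_near. Qed.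

Lemma radT_ge4 t : 4 <= t -> radT t = - gam.
Proof.
move=> t4; have [//|h1 h2] := @th12_cst 1 t t.
  near=> y; rewrite theta_ge3//; apply: ltW; near: y; apply: lt_nbhsr.
  by rewrite (lt_le_trans _ t4)// ltr_nat.
rewrite /radT h1 h2 theta_ge3 ?(le_trans _ t4)// ?ler_nat// !mulr0; lra.
Unshelve. all: by end_near. Qed.

Lemma continuous_radT : continuous radT.
Proof.
have c1 : continuous th1 by move=> y; exact: is_derive_continuous (derive_th1 y).
have c2 : continuous th2.
  by move=> y; have [_ /(_ tt) [_ [_ /(_ tt) [_ [+ _]]]]] := Ck_th 2; apply.
have c0 : continuous theta by move=> y; exact: is_derive_continuous (derive_th y).
move=> y; apply: cvgB; last by apply: cvgM; [exact: cvg_cst|exact: c0].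
apply: cvgD; apply: cvgM; [|exact: c2| |exact: c1].
  apply: cvgM; [exact: cvg_cst|exact: exprn_continuous].
by apply: cvgM; [exact: cvg_cst|exact: cvg_id].
Qed.

(** Constant on both sides of [1, 4] and continuous on that compact interval. The bound concerns the
    rescaled variable s/a, so it is the same for all scales and for any number of shells. *)
Lemma radT_bounded : exists2 C, 0 <= C & forall t, `|radT t| <= C.
Proof.
have cT := continuous_radT.
have /compact_bounded [M [_ HM]] : compact (radT @` `[1, 4]%classic).
  by apply: continuous_compact; [exact: continuous_subspaceT|exact: segment_compact].
exists (`|M| + 1 + `|gam|); first by rewrite !addr_ge0.
move=> t; have [t1|t1] := leP t 1; first by rewrite radT_le1// normr0 !addr_ge0.
have [t4|t4] := leP 4 t; first by rewrite radT_ge4// normrN lerDr addr_ge0.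
apply: (@le_trans _ _ (`|M| + 1)); last by rewrite lerDl.
apply: HM; first by rewrite ltr_pwDr// ler_norm.
by exists t => //=; rewrite in_itv/= !ltW.
Qed.

End oned.

(** * Derivatives of radial functions *)

Section radial.
Context {R : realType} {n : nat}.
Implicit Types (x : 'rV[R]_n) (i j : 'I_n) (F : R -> R).
Local Notation dd i f := ('D_(delta_mx 0 i : 'rV[R]_n) f).

Lemma near_sqn_gt0 x : 0 < sqn x -> \forall y \near x, 0 < sqn y.
Proof. by move=> x0; have /(cvgr_gt _) := @continuous_sqn R n x; apply. Qed.

Lemma is_derive_radial F (F1 : R) x i : is_derive (sqn x) 1 F F1 ->
  is_derive x (delta_mx 0 i) (F \o @sqn R n) (2 * x 0 i * F1).
Proof.
move=> [d1 d2]; have [e1 e2] := is_derive_sqn x i.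
by have := is_derive_comp1 e1 d1; rewrite e2 d2 mulrC.
Qed.

Lemma derive2_radial F F1 F2 x i j : (forall s : R, 0 < s -> is_derive s 1 F (F1 s)) ->
  (forall s : R, 0 < s -> is_derive s 1 F1 (F2 s)) -> 0 < sqn x ->
  dd j (dd i (F \o @sqn R n)) x =
  2 * F1 (sqn x) *+ (i == j) + 4 * x 0 i * x 0 j * F2 (sqn x).
Proof.
move=> dF dF1 x0.
transitivity (dd j ((fun y : 'rV[R]_n => 2 * y 0 i) \* (F1 \o @sqn R n)) x).
  apply: near_eq_derive; near=> y; apply: derive_val; apply: is_derive_radial; apply: dF.
  by near: y; exact: near_sqn_gt0.
have [d1 d2] := is_derive_radial j (dF1 _ x0).
have [e1 e2] : is_derive x (delta_mx 0 j) (fun y : 'rV[R]_n => 2 * y 0 i) (2 *+ (i == j)).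
  have [c1 c2] := is_derive_coord x (delta_mx 0 j) i.
  split; first exact: (derivableM (derivable_cst (2 : R) _ _) c1).
  rewrite [LHS](deriveM (derivable_cst (2 : R) _ _) c1) derive_cst scaler0 addr0 c2.
  by rewrite mxE eqxx/= [_ *: _]mulr_natr.
rewrite [LHS](deriveM e1 d1) d2 e2 /=.
by case: eqP => _; rewrite ?mulr1n ?mulr0n -![_ *: _]/(_ * _); ring.
Unshelve. all: by end_near. Qed.

End radial.

Section profile.
Context {R : realType}.
Variables (q a b : R).
Hypotheses (a0 : 0 < a) (b0 : 0 < b).
Implicit Types (s : R).

Let th1 : R -> R := 'D_1 theta.
Let th2 : R -> R := 'D_1 th1.

Let Ck_th k : Ck1 k setT (@theta R). Proof. by apply: Ck1_theta; exact: openT. Qed.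

Let derive_th s : is_derive s 1 theta (th1 s).
Proof. by apply/derivableP; have [_ /(_ tt) [+ _]] := Ck_th 1; apply. Qed.

Let derive_th1 s : is_derive s 1 th1 (th2 s).
Proof. by apply/derivableP; have [_ /(_ tt) [_ [_ /(_ tt) [+ _]]]] := Ck_th 2; apply. Qed.

(** The variable s stands for |x|^2, so this is |x|^(-2q) cut off at two scales: the first step
    switches it on between 2a and 3a, the second switches it off between 2b and 3b. *)
Definition profile s : R := s `^ (- q) * (theta (s * a^-1) - theta (s * b^-1)).

Let chi s := theta (s * a^-1) - theta (s * b^-1).
Let chi1 s := th1 (s * a^-1) * a^-1 - th1 (s * b^-1) * b^-1.
Let chi2 s := th2 (s * a^-1) * a^-1 * a^-1 - th2 (s * b^-1) * b^-1 * b^-1.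

Definition profile1 s : R := - q * s `^ (- q - 1) * chi s + s `^ (- q) * chi1 s.

Definition profile2 s : R := - q * ((- q - 1) * s `^ (- q - 2)) * chi s +
  2 * (- q) * s `^ (- q - 1) * chi1 s + s `^ (- q) * chi2 s.

Let is_derive_chi s : is_derive s 1 chi (chi1 s).
Proof.
by apply: is_deriveB; apply: is_derive_scale_comp.
Qed.

Let is_derive_chi1 s : is_derive s 1 chi1 (chi2 s).
Proof.
have D c : is_derive s 1 (fun t => th1 (t * c) * c) (th2 (s * c) * c * c).
  have := is_derive_mulR (is_derive_scale_comp (derive_th1 (s * c))) (is_derive_cst c s 1).
  rewrite mulr0 addr0; exact.
by apply: is_deriveB.
Qed.

Lemma is_derive_profile s : 0 < s -> is_derive s 1 profile (profile1 s).
Proof.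
by move=> s0; exact: (is_derive_mulR (is_derive1_powR (- q) s0) (is_derive_chi s)).
Qed.

Lemma is_derive_profile1 s : 0 < s -> is_derive s 1 profile1 (profile2 s).
Proof.
move=> s0.
have D1 := is_derive_mulR (is_derive1_powR (- q) s0) (is_derive_chi1 s).
have D2 := is_derive_mulR (is_derive_mulR (is_derive_cst (- q) s 1)
   (is_derive1_powR (- q - 1) s0)) (is_derive_chi s).
have [H1 H2] := is_deriveD D2 D1; split; first exact: H1.
rewrite [LHS]H2 /profile2 /= (_ : - q - 1 - 1 = - q - 2); ring.
Qed.

(** The power is singular at 0, but both steps vanish for s below the smaller of [a] and [b]; the
    two regions are open and cover the line. *)
Lemma Ck1_profile k : Ck1 k setT profile.
Proof.
have chiC U : open U -> Ck1 k U chi.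
  move=> oU.
  have C c U' : open U' -> Ck1 k U' (fun s => theta (s * c)).
    move=> oU'; rewrite (_ : (fun s => _) = theta \o (fun s => c * s + 0)).
      exact: (@Ck1_comp _ _ _ setT _ _ oU' (fun _ _ => I) (Ck_th k) (Ck1_affine _ _ _ _)).
    by apply/funext => s /=; rewrite addr0 mulrC.
  rewrite (_ : chi = (fun s => theta (s * a^-1)) \+ (fun s => -1 * theta (s * b^-1))).
    by apply: CkD => //; [exact: C|apply: CkZ => //; exact: C].
  by apply/funext => s /=; rewrite mulN1r.
have c0 : 0 < Num.min a b by rewrite lt_min a0.
rewrite (_ : setT = [set s | 0 < s] `|` [set s | s < Num.min a b]); last first.
  apply/seteqP; split => // s _ /=.
  by have [s0|s0] := ltP 0 s; [left|right; exact: le_lt_trans c0].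
apply: Ck_glue.
  apply: CkM; [exact: open_gt|exact: Ck1_powR|apply: chiC; exact: open_gt].
apply: (@Ck_eq _ _ _ _ _ _ (cst 0)); [exact: open_lt| |exact: Ck_cst].
move=> s; rewrite inE/= lt_min => /andP[sa sb].
rewrite /profile !theta_le2 ?subrr ?mulr0//.
  by rewrite ler_pdivrMr// (le_trans (ltW sb))// ler_peMl ?(ltW b0)// ler1n.
by rewrite ler_pdivrMr// (le_trans (ltW sa))// ler_peMl ?(ltW a0)// ler1n.
Qed.

(** The left side is the Laplacian of F(|x|^2) in dimension N, for F = [profile]. It is linear in
    the cut-off, so each of the two steps contributes its own [radT]; the pure power gives the
    coefficient 4q(q+1) - 2Nq = -gam. *)
Lemma profile_lap (N gam s : R) : 0 < s -> gam = 2 * q * (N - 2 - 2 * q) ->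
  2 * N * profile1 s + 4 * s * profile2 s =
  s `^ (- q - 1) * (radT 4 (2 * N - 8 * q) gam (s * a^-1) -
                    radT 4 (2 * N - 8 * q) gam (s * b^-1)).
Proof.
move=> s0 ->.
have E1 : s `^ (- q - 1) = s `^ (- q - 2) * s.
  rewrite (_ : - q - 1 = (- q - 2) + 1); last by ring.
  by rewrite powRD ?powRr1 ?ltW// (gt_eqF s0) implybT.
have E0 : s `^ (- q) = s `^ (- q - 2) * s ^+ 2.
  rewrite -powR_mulrn ?ltW// -powRD; last by rewrite (gt_eqF s0) implybT.
  by congr (_ `^ _); ring.
have RT A B g t : radT A B g t = A * t ^+ 2 * th2 t + B * t * th1 t - g * theta t by [].
rewrite /profile1 /profile2 /chi2 /chi1 /chi !RT E0 E1.
move: (s `^ _) (theta (s * a^-1)) (theta (s * b^-1)) (th1 (s * a^-1)) (th1 (s * b^-1))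
  (th2 (s * a^-1)) (th2 (s * b^-1)) => P t0 t0' t1 t1' t2 t2'.
move: a^-1 b^-1 => a' b'; ring.
Qed.

End profile.

(** * Dyadic shells and the scale invariant measure *)

Section shell.
Context {R : realType} {n : nat}.
Local Notation mu := (@lebesgue_rV R n).
Implicit Types (x : 'rV[R]_n) (c d e : R).

(** The bounds are on |x|^2, so a dyadic shell in |x| has d = 4c. *)
Definition shell c d : set 'rV[R]_n := [set x | c <= sqn x < d].

(* The scale invariant weight |x|^(-n). *)
Definition critw x : R := sqn x `^ (- (n%:R / 2)).

Lemma measurable_shell c d : measurable (shell c d).
Proof.
have -> : shell c d = @sqn R n @^-1` `[c, d[.
  by apply/seteqP; split => x /=; rewrite in_itv.
rewrite -[X in measurable X]setTI.
apply: (continuous_measurable_rV measurableT continuous_sqn) => //.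
Qed.

Lemma measurable_critw D : measurable D -> measurable_fun D critw.
Proof. exact: measurable_sqn_powR. Qed.

Lemma critw_ge0 x : 0 <= critw x. Proof. exact: powR_ge0. Qed.

Definition shell_mass c d : \bar R := (\int[mu]_(x in shell c d) (critw x)%:E)%E.

Lemma sqn_double x : sqn (2 *: x) = 4 * sqn x.
Proof.
rewrite /sqn mulr_sumr; apply: eq_bigr => i _; rewrite mxE; ring.
Qed.

Lemma critw_double x : critw (2 *: x) = (2 ^+ n)^-1 * critw x.
Proof.
rewrite /critw sqn_double powRM ?sqn_ge0//; congr (_ * _).
rewrite powRN; congr (_^-1).
have -> : 4 = 2 `^ 2 :> R by rewrite powR_mulrn//; ring.
rewrite -powRrM -powR_mulrn//; congr (_ `^ _).
by rewrite mulrC divfK.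
Qed.

Lemma shell_massE c d : shell_mass c d = (\int[mu]_x (\1_(shell c d) x * critw x)%:E)%E.
Proof.
rewrite /shell_mass -[in LHS](setTI (shell c d)) integral_mkcondr.
apply: eq_integral => x _; rewrite patchE indicE.
by case: ifPn => _; rewrite ?mul1r ?mul0r.
Qed.

Lemma measurable_shell_critw c d :
  measurable_fun setT (fun x : 'rV[R]_n => (\1_(shell c d) x * critw x)%:E).
Proof.
apply/measurable_EFinP; apply: measurable_funM; last exact: measurable_critw.
by apply: measurable_indic; exact: measurable_shell.
Qed.

Lemma measurable_double : measurable_fun setT (fun x : 'rV[R]_n => 2 *: x).
Proof.
apply: measurable_fun_rV => i; under eq_fun do rewrite mxE.
by apply: measurable_funM => //; exact: measurable_coor.
Qed.

(** Under x -> 2x the Jacobian 2^n cancels the factor 2^(-n) of the weight. *)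
Lemma shell_mass_scale c d : shell_mass (4 * c) (4 * d) = shell_mass c d.
Proof.
rewrite !shell_massE ge0_integral_double.
- rewrite -ge0_integralZl_EFin//; first last.
  + exact: (measurableT_comp (measurable_shell_critw _ _) measurable_double).
  + by move=> x _; rewrite lee_fin mulr_ge0// ?critw_ge0// indicE.
  apply: eq_integral => x _; rewrite -EFinM critw_double; congr (_%:E).
  have -> : \1_(shell (4 * c) (4 * d)) (2 *: x) = \1_(shell c d) x :> R.
    rewrite !indicE (_ : (2 *: x \in _) = (x \in shell c d))//; apply/idP/idP; rewrite !inE /shell/= sqn_double.
      by rewrite ler_pM2l// ltr_pM2l.
    by rewrite ler_pM2l// ltr_pM2l.
  by rewrite mulrCA mulVKf// expf_neq0.
- exact: measurable_shell_critw.
- by move=> x; rewrite lee_fin mulr_ge0// ?critw_ge0// indicE.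
Qed.

Lemma ge0_integral_shell_add (f : 'rV[R]_n -> R) c d e : c <= d -> d <= e ->
  measurable_fun setT f -> (forall x, 0 <= f x) ->
  (\int[mu]_(x in shell c e) (f x)%:E =
   \int[mu]_(x in shell c d) (f x)%:E + \int[mu]_(x in shell d e) (f x)%:E)%E.
Proof.
move=> cd de mf f0.
have -> : shell c e = shell c d `|` shell d e.
  apply/seteqP; split => x; rewrite /shell/=.
    move=> /andP[h1 h2]; have [h|h] := ltP (sqn x) d; [left|right].
      by apply/andP.
    by apply/andP.
  move=> [/andP[h1 h2]|/andP[h1 h2]]; apply/andP; split => //.
    exact: lt_le_trans de.
  exact: le_trans h1.
rewrite ge0_integral_setU//; try exact: measurable_shell.
- by apply/measurable_EFinP; exact: measurable_funTS.
- by move=> x _; rewrite lee_fin.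
- apply/disj_set2P; apply/seteqP; split => // x [] /andP[_ h1] /andP[h2 _].
  by move: h1; rewrite ltNge h2.
Qed.

Lemma shell_mass_add c d e : c <= d -> d <= e ->
  shell_mass c e = (shell_mass c d + shell_mass d e)%E.
Proof.
by move=> cd de; apply: ge0_integral_shell_add => //; [exact: measurable_critw|exact: critw_ge0].
Qed.

Lemma shell_cbox c d : 0 < d -> shell c d `<=` cbox (const_mx (- Num.sqrt d)) (const_mx (Num.sqrt d)).
Proof.
move=> d0 x /andP[_ xd]; apply: eball_cbox; first by rewrite sqrtr_gt0.
by rewrite eball_sqn ?sqrtr_gt0//= sqr_sqrtr// ltW.
Qed.

Lemma shell_mass_fin c d : 0 < c -> 0 < d -> (shell_mass c d < +oo)%E.
Proof.
move=> c0 d0.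
have fin : (mu (shell c d) < +oo)%E.
  apply: le_lt_trans (lebesgue_cbox_fin (const_mx (- Num.sqrt d)) (const_mx (Num.sqrt d))).
  apply: le_measure; rewrite ?inE; [exact: measurable_shell|exact: measurable_cbox|exact: shell_cbox].
apply: (@le_lt_trans _ _ (\int[mu]_(x in shell c d) (c `^ (- (n%:R / 2)))%:E)%E).
  apply: ge0_le_integral => //; first exact: measurable_shell.
  - by move=> x _; rewrite lee_fin critw_ge0.
  - by apply/measurable_EFinP; apply: measurable_critw; exact: measurable_shell.
  - move=> x /andP[cx _]; rewrite lee_fin /critw !powRN lef_pV2 ?posrE ?powR_gt0//.
      by rewrite ge0_ler_powR ?nnegrE ?divr_ge0 ?(ltW c0) ?sqn_ge0.
    exact: lt_le_trans cx.
by rewrite integral_cst ?lte_mul_pinfty ?lee_fin ?powR_ge0//; exact: measurable_shell.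
Qed.

Lemma shell_mass_gt0 c : (0 < n)%N -> 0 < c -> (0 < shell_mass c (4 * c))%E.
Proof.
move=> n0 c0; have N0 : 0 < n%:R :> R by rewrite ltr0n.
(* Chosen with n t^2 = c, so that on the cube [t, 3t/2]^n the square |x|^2 runs between c and 9c/4 <
   4c. The cube lies in the shell and has positive measure. *)
pose t := Num.sqrt (c / n%:R); have t0 : 0 < t by rewrite sqrtr_gt0 divr_gt0.
have tE : t ^+ 2 = c / n%:R by rewrite sqr_sqrtr// divr_ge0 ?(ltW c0) ?(ltW N0).
have sumc (k : R) : \sum_(i < n) k = n%:R * k by rewrite sumr_const card_ord mulr_natl.
pose K : set 'rV[R]_n := cbox (const_mx t) (const_mx (3 / 2 * t)).
have mK : measurable K := measurable_cbox _ _.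
have KS : K `<=` shell c (4 * c).
  move=> x Kx; have h i : t ^+ 2 <= x 0 i ^+ 2 <= (3 / 2 * t) ^+ 2.
    have := Kx i; rewrite in_itv/= !mxE => /andP[h1 h2].
    have x0 : 0 <= x 0 i := le_trans (ltW t0) h1.
    have t1 : 0 <= 3 / 2 * t := le_trans x0 h2.
    by apply/andP; split; rewrite ler_pXn2r ?nnegrE// (ltW t0).
  apply/andP; split.
    rewrite (_ : c = \sum_(i < n) t ^+ 2); last by rewrite sumc tE mulrC divfK// gt_eqF.
    by apply: ler_sum => i _; have /andP[] := h i.
  apply: (@le_lt_trans _ _ (\sum_(i < n) (3 / 2 * t) ^+ 2)).
    by apply: ler_sum => i _; have /andP[] := h i.
  rewrite sumc exprMn tE (_ : n%:R * _ = (3 / 2) ^+ 2 * c); last first.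
    by rewrite mulrCA; congr (_ * _); rewrite mulrC divfK// gt_eqF.
  by rewrite ltr_pM2r//; lra.
have d0 : 0 < (4 * c) `^ (- (n%:R / 2)) by rewrite powR_gt0// mulr_gt0.
apply: (@lt_le_trans _ _ (\int[mu]_(x in K) ((4 * c) `^ (- (n%:R / 2)))%:E)%E).
  have muK : mu K = (\prod_(i < n) ((const_mx (3 / 2 * t) : 'rV[R]_n) 0 i - (const_mx t : 'rV[R]_n) 0 i))%:E.
    by apply: lebesgue_rV_box => i; rewrite !mxE ler_peMl ?(ltW t0)//; lra.
  have H : (0 < ((4 * c) `^ (- (n%:R / 2)))%:E * mu K)%E.
    rewrite muK -EFinM lte_fin mulr_gt0// prodr_gt0// => i _.
    by rewrite !mxE subr_gt0 ltr_pMl//; lra.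
  by rewrite integral_cst.
apply: (@le_trans _ _ (\int[mu]_(x in K) (critw x)%:E)%E).
  apply: ge0_le_integral => //.
  - by move=> x _; rewrite lee_fin ltW.
  - by apply/measurable_EFinP; exact: measurable_critw.
  - move=> x /KS /andP[cx xc]; rewrite lee_fin /critw !powRN.
    have x0 : 0 < sqn x by exact: lt_le_trans cx.
    rewrite lef_pV2 ?posrE ?powR_gt0 ?mulr_gt0//.
    by rewrite ge0_ler_powR ?nnegrE ?divr_ge0 ?(ltW x0) ?(ltW xc)// mulr_ge0 ?(ltW c0).
apply: ge0_subset_integral => //; first exact: measurable_shell.
- by apply/measurable_EFinP; apply: measurable_critw; exact: measurable_shell.
- by move=> x _; rewrite lee_fin critw_ge0.
Qed.

Lemma shell_mass_geometric b k : 0 < b ->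
  shell_mass (b / 4 ^+ k) (4 * (b / 4 ^+ k)) = shell_mass b (4 * b).
Proof.
move=> b0; elim: k => [|k <-]; first by rewrite expr0 divr1.
rewrite -[in LHS]shell_mass_scale; congr (shell_mass _ _); last congr (_ * _);
  by rewrite exprS invfM mulrCA mulVKf.
Qed.

Lemma shell_mass_sum b k : 0 < b ->
  shell_mass (b / 4 ^+ k) b = (k%:R%:E * shell_mass b (4 * b))%E.
Proof.
move=> b0; elim: k => [|k IH].
  rewrite expr0 divr1 mul0e /shell_mass (_ : shell b b = set0) ?integral_set0//.
  by apply/seteqP; split => // x /andP[h1 h2]; move: h2; rewrite ltNge h1.
have E : 4 * (b / 4 ^+ k.+1) = b / 4 ^+ k by rewrite exprS invfM mulrCA mulVKf.
have k0 : 0 < b / 4 ^+ k.+1 by rewrite divr_gt0// exprn_gt0.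
rewrite (@shell_mass_add _ (b / 4 ^+ k)).
- rewrite -[in X in (X + _)%E]E shell_mass_geometric// IH.
  rewrite -[k.+1%:R]natr1 EFinD addeC ge0_muleDl ?mul1e//; by rewrite lee_fin ler0n.
- by rewrite -E ler_peMl ?(ltW k0)//; lra.
- rewrite ler_pdivrMr ?exprn_gt0// ler_peMr ?(ltW b0)// exprn_ege1//; lra.
Qed.

End shell.

(** * Test functions as elements of H^2_0 *)

Section test_sobolev.
Context {R : realType} {n : nat}.
Local Notation mu := (@lebesgue_rV R n).
Variables (W : set 'rV[R]_n) (a b : 'rV[R]_n) (psi : 'rV[R]_n -> R).
Hypotheses (oW : open W) (Wab : W `<=` cbox a b) (tpsi : test_function W psi).
Hypothesis psiC : forall i j x, 'D_(delta_mx 0 i) ('D_(delta_mx 0 j) psi) x =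
  'D_(delta_mx 0 j) ('D_(delta_mx 0 i) psi) x.

Lemma test_partials s : test_function W (partials s psi).
Proof. by elim: s => [//|i s IH]; exact: test_partial. Qed.

(** Moving D_i D_j from [phi] to [psi] by two integrations by parts yields D_j D_i psi, whereas
    [partials [:: i; j] psi] is D_i D_j psi; this is where [psiC] is used. *)
Lemma test_weak_partials s : (size s <= 2)%N -> weak_partials W s psi (partials s psi).
Proof.
have mW := open_measurable_rV oW.
have lc f : test_function W f -> loc_integrable W f.
  by move=> [sf _ _]; apply: continuous_loc_integrable => //; exact: smooth_continuous.
have sm f : test_function W f -> smooth f by case.
move=> s2; split; [exact: lc|exact: lc (test_partials s)|move=> phi tp].
case: s s2 => [|i [|j []]]//= _; first by rewrite expr0 mul1r.
- by rewrite expr1 mulN1r Rintegral_test_parts//; exact: sm.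
- rewrite (Rintegral_test_parts i oW (sm _ tpsi) (test_partial j tp)).
  rewrite (Rintegral_test_parts j oW (sm _ (test_partial i tpsi)) tp).
  rewrite opprK expr2 mulrNN mulr1 mul1r; apply: eq_Rintegral => x _.
  by rewrite psiC.
Qed.

Lemma test_wpartials s : (size s <= 2)%N ->
  {ae mu, forall x, W x -> wpartials W s psi x = partials s psi x}.
Proof. by move=> s2; exact: (wpartialsP oW (test_weak_partials s2)).2. Qed.

Lemma test_sobolev0_2 : sobolev0 2 W psi.
Proof.
have mW := open_measurable_rV oW.
split.
  split; first exact: (sqint_test oW Wab tpsi).
  move=> s s2; exists (partials s psi); first exact: test_weak_partials.
  exact: (sqint_test oW Wab (test_partials s)).
(* The constant sequence: the integrals are 0 because the chosen weak derivatives agree almost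
   everywhere with the classical ones. *)
exists (fun=> psi); split => // s s2.
rewrite (_ : (fun _ => _) = cst 0%E); first exact: cvg_cst.
apply/funext => _ /=; have ts := test_partials s.
have mts : measurable_fun W (partials s psi).
  by apply: continuous_measurable_rV => //; case: ts => /smooth_continuous.
rewrite (@ae_eq_integral _ _ _ mu W (cst 0%E))//.
- by rewrite integral0.
- apply/measurable_EFinP; apply: measurable_funX; apply: measurable_funB => //.
  by have [[_ [+ _] _] _] := wpartialsP oW (test_weak_partials s2).
- by apply: filterS (test_wpartials s2) => x h /h ->; rewrite subrr expr0n.
Qed.

Lemma test_wlaplacian : {ae mu, forall x, W x -> wlaplacian W psi x =
  \sum_i 'D_(delta_mx 0 i) ('D_(delta_mx 0 i) psi) x}.
Proof.
have : {ae mu, forall x, forall i, W x -> wpartials W [:: i; i] psi x =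
    'D_(delta_mx 0 i) ('D_(delta_mx 0 i) psi) x}.
  by apply: filter_forall => i; exact: (@test_wpartials [:: i; i] isT).
by apply: filterS => x h Wx; apply: eq_bigr => i _; exact: h.
Qed.

End test_sobolev.

(** * The cut-off power and its two integrals *)

Section minimizer.
Context {R : realType} {n : nat}.
Local Notation mu := (@lebesgue_rV R n).
Variables (m r b : R) (L : nat).
Hypotheses (n0 : (0 < n)%N) (r0 : 0 < r) (b0 : 0 < b) (br : 4 * b < r ^+ 2).
Let N : R := n%:R.
Let q : R := (N - 4 - 2 * m) / 4.
Let gam : R := (N - 4 - 2 * m) * (N + 2 * m) / 4.
(** The plateau [4a, b) then consists of exactly [L] dyadic shells, between the transition shells
    [a, 4a) and [b, 4b). *)
Let a : R := b / 4 ^+ L.+1.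
Let W : set 'rV[R]_n := eball r.
Let T := radT 4 (2 * N - 8 * q) gam.

Definition minimizer : 'rV[R]_n -> R := profile q a b \o @sqn R n.

Let a0 : 0 < a. Proof. by rewrite divr_gt0// exprn_gt0. Qed.

Let a4b : 4 * a <= b.
Proof.
rewrite /a exprS invfM mulrCA mulVKf// ler_pdivrMr ?exprn_gt0//.
by rewrite ler_peMr ?(ltW b0)// exprn_ege1//; lra.
Qed.

Let oW : open W := open_eball r0.
Let mW : measurable W := open_measurable_rV oW.

Let profile_out s : s <= a \/ 4 * b <= s -> profile q a b s = 0.
Proof.
rewrite /profile => -[sa|sb].
  rewrite !theta_le2 ?subrr ?mulr0//.
    by rewrite ler_pdivrMr//; have := a0; have := a4b; lra.
  by rewrite ler_pdivrMr//; have := a0; lra.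
rewrite !theta_ge3 ?subrr ?mulr0//.
  by rewrite ler_pdivlMr//; have := b0; lra.
by rewrite ler_pdivlMr//; have := a0; have := a4b; have := b0; lra.
Qed.

Lemma smooth_minimizer : smooth minimizer.
Proof.
apply/smoothP => k; apply: (@Ck_comp _ _ _ _ _ _ setT); first exact: openT.
- by [].
- exact: Ck1_profile.
- by apply: Ck_sqn; exact: openT.
Qed.

Lemma test_minimizer : test_function W minimizer.
Proof.
have sub : closure [set x | minimizer x != 0] `<=` [set x | sqn x <= 4 * b].
  rewrite closureE; apply: smallest_sub.
    apply: (@closed_comp _ _ (@sqn R n) [set t | t <= 4 * b]); last exact: closed_le.
    by move=> x _; exact: continuous_sqn.
  move=> x /=; apply: contra_neqT; rewrite -ltNge => /ltW h.
  by rewrite /minimizer/= profile_out//; right.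
have KW : [set x | sqn x <= 4 * b] `<=` W.
  by move=> x /= xb; rewrite /W eball_sqn//=; exact: le_lt_trans br.
split; first exact: smooth_minimizer.
  have sub2 := subset_trans (subset_trans sub KW) (eball_cbox r0).
  by apply: subclosed_compact sub2; [exact: closed_closure|exact: compact_cbox].
exact: subset_trans KW.
Qed.

Let D1 (s : R) : 0 < s -> is_derive s 1 (profile q a b) (profile1 q a b s).
Proof. exact: is_derive_profile. Qed.

Let D2 (s : R) : 0 < s -> is_derive s 1 (profile1 q a b) (profile2 q a b s).
Proof. exact: is_derive_profile1. Qed.

(** Off the origin the formula for second derivatives of a radial function is symmetric in the two
    directions; near the origin the function vanishes. *)
Lemma minimizerC i j x : 'D_(delta_mx 0 i) ('D_(delta_mx 0 j) minimizer) x =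
  'D_(delta_mx 0 j) ('D_(delta_mx 0 i) minimizer) x.
Proof.
have [x0|x0] := ltP 0 (sqn x).
  rewrite [LHS](derive2_radial j i D1 D2 x0) [RHS](derive2_radial i j D1 D2 x0).
  by rewrite eq_sym; congr (_ + _ * _); exact: mulrAC.
have z k l : 'D_(delta_mx 0 k) ('D_(delta_mx 0 l) minimizer) x = 0.
  have nx : \forall y \near x, minimizer y = 0.
    have : \forall y \near x, sqn y < a.
      by have /(cvgr_lt _) := @continuous_sqn R n x; apply; exact: le_lt_trans a0.
    by apply: filterS => y ya; rewrite /minimizer/= profile_out//; left; exact: ltW.
  rewrite -(derive_cst (0 : R) x (delta_mx 0 k)); apply: near_eq_derive.
  have /nbhs_interior := nx; apply: filterS => y ny.
  by rewrite -(derive_cst (0 : R) y (delta_mx 0 l)); apply: near_eq_derive; exact: ny.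
by rewrite [LHS]z [RHS]z.
Qed.

Lemma minimizer_lap x : 0 < sqn x ->
  \sum_i 'D_(delta_mx 0 i) ('D_(delta_mx 0 i) minimizer) x =
  sqn x `^ (- q - 1) * (T (sqn x * a^-1) - T (sqn x * b^-1)).
Proof.
move=> x0; rewrite -(@profile_lap _ _ _ _ N) //; last by rewrite /gam /q; field.
rewrite (eq_bigr _ (fun i _ => derive2_radial i i D1 D2 x0)).
under eq_bigr do rewrite eqxx mulr1n.
rewrite big_split/= sumr_const card_ord -[_ *+ n]mulr_natl mulrA [_%:R * 2]mulrC; congr (_ + _).
rewrite -mulr_suml; congr (_ * _).
by rewrite /sqn mulr_sumr; apply: eq_bigr => i _; rewrite -mulrA -expr2.
Qed.

Let lapf (x : 'rV[R]_n) : R := critw x * (T (sqn x * a^-1) - T (sqn x * b^-1)) ^+ 2.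

Let mT c (D : set 'rV[R]_n) : measurable D -> measurable_fun D (fun x => T (sqn x * c)).
Proof.
move=> mD; apply: continuous_measurable_rV => // x.
apply: (@continuous_comp _ _ _ (fun x => sqn x * c) T); last exact: continuous_radT.
by apply: (cvgM (@continuous_sqn R n x)); exact: cvg_cst.
Qed.

Let mlapf (D : set 'rV[R]_n) : measurable D -> measurable_fun D lapf.
Proof.
move=> mD; apply: measurable_funM; first exact: measurable_critw.
by apply: measurable_funX; apply: measurable_funB; exact: mT.
Qed.

Let numE : rellich_num m W minimizer = (\int[mu]_(x in W) (lapf x)%:E)%E.
Proof.
rewrite rellich_numE; apply: ae_eq_integral => //.
- apply/measurable_EFinP; apply: measurable_funM; first exact: measurable_sqn_powR.
  have s0 := test_sobolev0_2 oW (eball_cbox r0) test_minimizer minimizerC.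
  apply: measurable_funX; apply: (@sqint_measurable _ _ _ mu).
  apply: (sqint_sum mW _ (mu_boundedW oW (eball_cbox r0))) => i.
  by have [[]] := (sobolev_wpartials (s := [:: i; i]) oW s0.1 isT).
- by apply/measurable_EFinP; exact: mlapf.
apply: filterS2 (ae_sqn_neq0 (R := R) n0) (test_wlaplacian oW test_minimizer minimizerC).
move=> x x0 h Wx; congr (_%:E); rewrite h// minimizer_lap; last first.
  by rewrite lt_neqAle eq_sym x0 sqn_ge0.
rewrite exprMn mulrA /lapf /critw; congr (_ * _).
rewrite -powR_mulrn ?powR_ge0// -powRrM -powRD; last by rewrite x0 implybT.
(* The exponent is -m + 2(-q - 1) = -n/2: this is the condition that determines [q]. *)
by congr (_ `^ _); rewrite /q /N; field.
Qed.

Let lapf_ge0 x : 0 <= lapf x.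
Proof. by rewrite mulr_ge0 ?sqr_ge0// critw_ge0. Qed.

Let T_le1 t : t <= 1 -> T t = 0. Proof. exact: radT_le1. Qed.
Let T_ge4 t : 4 <= t -> T t = - gam. Proof. exact: radT_ge4. Qed.

Let shell_sub c d : d <= 4 * b -> shell c d `<=` W.
Proof.
move=> db x /andP[_ xd]; rewrite /W eball_sqn//=.
exact: lt_trans (lt_le_trans xd db) br.
Qed.

(** On the plateau T(s/a) = -gam and T(s/b) = 0, which gives gam^2 times the mass of [L] shells. On
    each of the two transition shells the squared difference is at most (2C)^2, whence 8 C^2. *)
Lemma minimizer_num_le (C : R) : 0 <= C -> (forall t, `|T t| <= C) ->
  (rellich_num m W minimizer <=
  ((gam ^+ 2 * L%:R + 8 * C ^+ 2)%R)%:E * @shell_mass R n b (4 * b))%E.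
Proof.
move=> C0 HC; rewrite numE.
have mS c d : measurable (shell c d : set 'rV[R]_n) := measurable_shell _ _.
have bound c d K : (forall x : 'rV[R]_n, shell c d x -> (T (sqn x * a^-1) - T (sqn x * b^-1)) ^+ 2 <= K) ->
    0 <= K -> (\int[mu]_(x in shell c d) (lapf x)%:E <= K%:E * @shell_mass R n c d)%E.
  move=> HK K0; rewrite /shell_mass -ge0_integralZl_EFin//; first last.
  - by apply/measurable_EFinP; exact: measurable_critw.
  - by move=> x _; rewrite lee_fin critw_ge0.
  apply: ge0_le_integral => //.
  - by move=> x _; rewrite lee_fin lapf_ge0.
  - by apply/measurable_EFinP; exact: mlapf.
  - apply/measurable_EFinP; apply: measurable_funM => //; exact: measurable_critw.
  - move=> x Sx; rewrite -EFinM lee_fin [K * _]mulrC /lapf.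
    by apply: ler_wpM2l; [exact: critw_ge0|exact: HK].
have K4 (x : 'rV[R]_n) : (T (sqn x * a^-1) - T (sqn x * b^-1)) ^+ 2 <= 4 * C ^+ 2.
  rewrite -real_normK ?num_real// (_ : 4 * C ^+ 2 = (2 * C) ^+ 2); last by ring.
  rewrite ler_pXn2r ?nnegrE ?mulr_ge0// (le_trans (ler_normB _ _))//.
  by rewrite mulr2n mulrDl mul1r lerD.
have C20 : 0 <= 4 * C ^+ 2 by rewrite mulr_ge0 ?sqr_ge0.
(* Below [a] both terms vanish; beyond 4b both equal -gam and cancel. *)
rewrite (integral_extend0 _ (@shell_sub a (4 * b) (lexx _)))//; last first.
  move=> x _ /negP; rewrite negb_and -ltNge -leNgt /lapf => /orP[sa|sb].
    rewrite !T_le1 ?subrr ?expr0n ?mulr0//.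
      by rewrite ler_pdivrMr//; have := a4b; have := a0; lra.
    by rewrite ler_pdivrMr//; lra.
  rewrite !T_ge4 ?subrr ?expr0n ?mulr0//.
    by rewrite ler_pdivlMr.
  by rewrite ler_pdivlMr//; have := a4b; have := a0; have := b0; lra.
have h1 : a <= 4 * a by have := a0; lra.
have h2 : b <= 4 * b by have := b0; lra.
rewrite (ge0_integral_shell_add h1 (le_trans a4b h2))//; last exact: mlapf.
rewrite (ge0_integral_shell_add a4b h2)//; last exact: mlapf.
have E : 4 * a = b / 4 ^+ L by rewrite /a exprS invfM mulrCA mulVKf.
have M1 : @shell_mass R n a (4 * a) = @shell_mass R n b (4 * b) by exact: shell_mass_geometric.
have M2 : @shell_mass R n (4 * a) b = (L%:R%:E * @shell_mass R n b (4 * b))%E.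
  by rewrite E; exact: shell_mass_sum.
have B1 := bound a (4 * a) _ (fun x _ => K4 x) C20.
have B3 := bound b (4 * b) _ (fun x _ => K4 x) C20.
have B2 : (\int[mu]_(x in shell (4 * a) b) (lapf x)%:E <=
    (gam ^+ 2)%:E * @shell_mass R n (4 * a) b)%E.
  apply: bound; last exact: sqr_ge0.
  move=> x /andP[ax xb]; rewrite T_ge4; last by rewrite ler_pdivlMr.
  rewrite T_le1; last by rewrite ler_pdivrMr// mul1r ltW.
  by rewrite subr0 sqrrN.
apply: (le_trans (leeD B1 (leeD B2 B3))); rewrite M1 M2.
have : @shell_mass R n b (4 * b) \is a fin_num.
  rewrite ge0_fin_numE; first by apply: shell_mass_fin => //; rewrite mulr_gt0.
  by apply: integral_ge0 => x _; rewrite lee_fin critw_ge0.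
move=> /fineK <-; rewrite -!EFinM -!EFinD lee_fin le_eqVlt; apply/orP; left; apply/eqP; ring.
Qed.

(** On the plateau the minimizer is exactly |x|^(-2q), and -(m + 2) - 2q = -n/2 turns the integrand
    into [critw]; the rest of the ball contributes a nonnegative amount. *)
Lemma minimizer_den_ge : (L%:R%:E * @shell_mass R n b (4 * b) <= rellich_den m W minimizer)%E.
Proof.
have E : 4 * a = b / 4 ^+ L by rewrite /a exprS invfM mulrCA mulVKf.
rewrite -shell_mass_sum// -E rellich_denE /shell_mass.
have mS : measurable (shell (4 * a) b : set 'rV[R]_n) := measurable_shell _ _.
have mden (D : set 'rV[R]_n) : measurable D ->
    measurable_fun D (fun x => (sqn x `^ (- (m + 2)) * minimizer x ^+ 2)%:E).
  move=> mD; apply/measurable_EFinP; apply: measurable_funM; first exact: measurable_sqn_powR.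
  apply: measurable_funX; apply: continuous_measurable_rV => //.
  exact: smooth_continuous smooth_minimizer.
have den0 x : (0 <= (sqn x `^ (- (m + 2)) * minimizer x ^+ 2)%:E)%E.
  by rewrite lee_fin mulr_ge0 ?sqr_ge0// powR_ge0.
apply: (@le_trans _ _ (\int[mu]_(x in shell (4 * a) b) (sqn x `^ (- (m + 2)) * minimizer x ^+ 2)%:E)%E).
  apply: ge0_le_integral => //.
  - by move=> x _; rewrite lee_fin critw_ge0.
  - by apply/measurable_EFinP; exact: measurable_critw.
  - exact: mden.
  - move=> x /andP[ax xb]; have x0 : 0 < sqn x by apply: lt_le_trans ax; rewrite mulr_gt0.
    rewrite lee_fin /minimizer /= /profile theta_ge3; last first.
      by rewrite ler_pdivlMr//; have := a0; lra.
    rewrite theta_le2; last by rewrite ler_pdivrMr//; have := b0; lra.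
    rewrite subr0 mulr1 -powR_mulrn ?powR_ge0// -powRrM -powRD; last by rewrite (gt_eqF x0) implybT.
    by rewrite /critw le_eqVlt; apply/orP; left; apply/eqP; congr (_ `^ _); rewrite /q /N; field.
apply: ge0_subset_integral => //; first exact: mden.
by apply: shell_sub; rewrite ler_peMl ?(ltW b0)//; lra.
Qed.

End minimizer.

(** * Comparison of quotients and conclusion *)

Section final.
Context {R : realType}.
Local Open Scope ereal_scope.

Lemma ratio_le (x y : \bar R) (p d : R) : (0 < d)%R -> 0 <= x -> x <= p%:E -> d%:E <= y ->
  x / y <= (p / d)%:E.
Proof.
move=> d0 x0 xp dy; have p0 : (0 <= p)%R by rewrite -lee_fin (le_trans x0).
case: y dy => [y| |]//.
- rewrite lee_fin => dy; have y0 : (0 < y)%R by exact: lt_le_trans dy.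
  rewrite inver gt_eqF// EFinM; apply: lee_pmul => //.
    by rewrite lee_fin invr_ge0 ltW.
  by rewrite lee_fin lef_pV2.
- by rewrite invey mule0 lee_fin divr_ge0// ltW.
Qed.

(** If y = +oo the quotient is 0, but then g y <= x < +oo forces g = 0, so the bound persists. This
    happens for g = gam^2 only at the endpoints of the range of [m]. *)
Lemma ratio_ge (x y : \bar R) (g : R) : (0 <= g)%R -> 0 <= x -> x < +oo -> 0 < y -> g%:E * y <= x ->
  g%:E <= x / y.
Proof.
move=> g0 x0 xoo; case: y => [y| |]//.
- rewrite lte_fin => y0; rewrite inver gt_eqF//.
  have : x \is a fin_num by rewrite ge0_fin_numE.
  by move=> /fineK <-; rewrite -!EFinM !lee_fin ler_pdivlMr.
- move=> _; rewrite invey mule0.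
  have [->|gn0] := eqVneq g 0%R; first by [].
  by rewrite gt0_muley ?lte_fin ?lt_neqAle 1?eq_sym ?gn0//= leye_eq => /eqP xE; rewrite xE in xoo.
Qed.

(** The weight is positive off the origin, a null set, so a vanishing integral would make [u] vanish
    almost everywhere. *)
Lemma rellich_den_gt0 n (m : R) (W : set 'rV[R]_n) (u : 'rV[R]_n -> R) : (0 < n)%N -> measurable W -> measurable_fun W u ->
  ~ {ae @lebesgue_rV R n, forall x, W x -> u x = 0%R} -> 0 < rellich_den m W u.
Proof.
move=> n0 mW mu nz; rewrite rellich_denE lt_neqAle; apply/andP; split; last first.
  by apply: integral_ge0 => x _; rewrite lee_fin mulr_ge0 ?sqr_ge0// powR_ge0.
apply/negP => /eqP E; apply: nz.
have mf : measurable_fun W (fun x => (sqn x `^ (- (m + 2)) * u x ^+ 2)%:E).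
  apply/measurable_EFinP; apply: measurable_funM; first exact: measurable_sqn_powR.
  exact: measurable_funX.
have H : {ae @lebesgue_rV R n, forall x, W x ->
    (sqn x `^ (- (m + 2)) * u x ^+ 2)%:E = 0}.
  apply: (ae_eq_integral_abs (@lebesgue_rV R n) mW mf).1.
  rewrite [RHS]E; apply: eq_integral => x _.
  by rewrite gee0_abs// lee_fin mulr_ge0 ?sqr_ge0// powR_ge0.
apply: filterS2 (ae_sqn_neq0 (R := R) n0) H => x x0 h Wx.
have := h Wx => -[] /eqP; rewrite mulf_eq0 powR_eq0 (negPf x0)/= sqrf_eq0.
by move=> /eqP.
Qed.

Lemma rellich_inf_upper n (m r : R) : (0 < n)%N -> (0 < r)%R ->
  rellich_inf m (eball r) (sobolev0 2 (@eball R n r)) <=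
  ((((n%:R - 4 - 2 * m) * (n%:R + 2 * m) / 4) ^+ 2)%R)%:E.
Proof.
move=> n0 r0; set gam := (_ / 4)%R.
(* The cut-off function vanishes for |x|^2 >= 4b = r^2/2, hence its support is compact in the
   ball. *)
pose b := (r ^+ 2 / 8)%R.
have b0 : (0 < b)%R by rewrite divr_gt0// exprn_gt0.
have br : (4 * b < r ^+ 2)%R by rewrite /b; have := exprn_gt0 2 r0; lra.
have [C C0 HC] := radT_bounded 4 (2 * n%:R - 8 * ((n%:R - 4 - 2 * m) / 4)) gam.
have V0 := shell_mass_gt0 n0 b0.
have Voo : @shell_mass R n b (4 * b) < +oo by apply: shell_mass_fin => //; rewrite mulr_gt0.
pose v := fine (@shell_mass R n b (4 * b)).
have vE : @shell_mass R n b (4 * b) = v%:E by rewrite fineK// ge0_fin_numE// ltW.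
have v0 : (0 < v)%R by rewrite -lte_fin -vE.
apply/lee_addgt0Pr => e e0.
(* The constant [C] was fixed before [L], so the share 8 C^2 / L of the transition shells can be
   made smaller than [e]. *)
have [L L0 Le] : exists2 L : nat, (0 < L%:R :> R)%R & (8 * C ^+ 2 / L%:R <= e)%R.
  exists (Num.truncn (8 * C ^+ 2 / e)).+1; first by rewrite ltr0n.
  rewrite ler_pdivrMr// [(e * _)%R]mulrC -ler_pdivrMr//; apply: ltW; exact: truncnS_gt.
have num := minimizer_num_le L n0 r0 b0 br C0 HC.
have den := minimizer_den_ge m L r0 b0 br (n := n).
set u := minimizer _ _ _ in num den.
rewrite vE in num den.
have s0 : sobolev0 2 (eball r) u.
  apply: (test_sobolev0_2 (open_eball r0) (eball_cbox r0)).
    exact: test_minimizer.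
  exact: minimizerC.
rewrite -EFinM in num; rewrite -EFinM in den.
apply: (@le_trans _ _ (rellich_num m (eball r) u / rellich_den m (eball r) u)).
  apply: ereal_inf_lbound; exists u => //; split => //.
  - move=> ae0; have : rellich_den m (eball r) u = 0.
      rewrite rellich_denE (@ae_eq_integral _ _ _ _ (eball r) (cst 0))//.
      + by rewrite integral0.
      + exact: open_measurable_rV (open_eball r0).
      + apply/measurable_EFinP; apply: measurable_funM.
          exact: measurable_sqn_powR (open_measurable_rV (open_eball r0)).
        apply: measurable_funX; apply: continuous_measurable_rV.
          exact: open_measurable_rV (open_eball r0).
        exact: smooth_continuous (smooth_minimizer _ _ b0).
      + by apply: filterS ae0 => x h /h ->; rewrite expr0n mulr0.
    by move=> d0; move: den; rewrite d0 lee_fin leNgt mulr_gt0.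
  - by apply: le_lt_trans num _; rewrite ltry.
apply: (le_trans (ratio_le _ _ num den)).
- by rewrite mulr_gt0.
- by apply: integral_ge0 => x _; rewrite lee_fin divr_ge0 ?sqr_ge0// powR_ge0.
rewrite -EFinD lee_fin.
rewrite (_ : _ / _ = gam ^+ 2 + 8 * C ^+ 2 / L%:R)%R ?lerD2l//.
by rewrite -/gam; field; rewrite !gt_eqF.
Qed.

End final.

Theorem mainTheorem4 (R : realType) (n : nat) (m r : R) :
  (1 <= n)%N -> - (n%:R / 2) <= m -> m <= (n%:R - 4) / 2 -> 0 < r ->
  let B : set 'rV[R]_n := eball r in
  rellich_inf m B (sobolev 2 B `&` sobolev0 1 B) =
  rellich_inf m B (sobolev0 2 B).
Proof.
move=> n0 m1 m2 r0 B; apply/eqP; rewrite eq_le; apply/andP; split.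
  (* An element of H^2_0 lies in both spaces: the approximating test functions are kept, and
     convergence is only retained up to order 1. *)
  apply: ereal_inf_le_tmp => _ [u [s0 nz fin] <-]; exists u => //; split => //.
  split; first by case: s0.
  have [[Lu H] [phi [tphi cphi]]] := s0.
  split; first by split => // s s1; apply: H; exact: leq_trans s1 _.
  by exists phi; split => // s s1; apply: cphi; exact: leq_trans s1 _.
(* The infimum over H^2_0 is at most gam^2, and gam^2 is at most each quotient on the larger
   class. *)
apply: le_ereal_inf_tmp => _ [u [s0 nz fin] <-].
apply: le_trans (rellich_inf_upper m n0 r0) _.
apply: ratio_ge => //.
- exact: sqr_ge0.
- by apply: integral_ge0 => x _; rewrite lee_fin divr_ge0 ?sqr_ge0// powR_ge0.
- apply: rellich_den_gt0 => //; first exact: open_measurable_rV (open_eball r0).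
  by case: s0 => -[[]].
- exact: rellich_lower.
Qed.
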